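(* Let $A\in\Omega_n\setminus\mathcal C_n$, that is, let $A\in\Omega_n$ be derogatory. (i) If $B\in\mathcal M_n$ and $\hat k_{\Omega_n}(A;B)=0$, then $B\in C'_A$. (ii) $C'_A\neq\ker\sigma_{\ast,A}$.
   Context: $\mathbb D$ is the open unit disc in $\mathbb C$. $\mathcal M_n$ is the set of all $n\times n$ complex matrices (identified with $\mathbb C^{n^2}$) and $I\in\mathcal M_n$ the identity matrix. For $A\in\mathcal M_n$, $sp(A)$ is the spectrum (set of eigenvalues) of $A$ and $r(A)=\max_{\lambda\in sp(A)}|\lambda|$ its spectral radius. The spectral ball is $\Omega_n:=\{A\in\mathcal M_n: r(A)<1\}$. A matrix is non-derogatory if all the blocks in its Jordan form have distinct eigenvalues, and derogatory otherwise; $\mathcal C_n$ is the set of all non-derogatory matrices in $\Omega_n$. The functions $\sigma_j:\mathcal M_n\to\mathbb C$ are defined by $\det(tI-A)=t^n+\sum_{j=1}^n(-1)^j\sigma_j(A)t^{n-j}$; $\sigma=(\sigma_1,\dots,\sigma_n):\mathcal M_n\to\mathbb C^n$ and $\sigma_{\ast,A}$ is the differential of $\sigma$ at $A$. Singular Kobayashi pseudometric: for $A\in\Omega_n$, $B\in\mathcal M_n$, $$\hat k_{\Omega_n}(A;B)=\inf\{|\alpha|:\alpha\in\mathbb C \text{ and there exist an integer } m\ge1 \text{ and a holomorphic } \varphi:\mathbb D\to\Omega_n \text{ with } \operatorname{ord}_0(\varphi-A)\ge m,\ \alpha\varphi^{(m)}(0)=m!\,B\},$$ where $\operatorname{ord}_0$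 denotes the order of vanishing at $0$. For a nonconstant function $g$ holomorphic near $A$, $g_A^*$ denotes the homogeneous polynomial of lowest nonzero degree in the Taylor expansion of $g$ at $A$, i.e. $g(X)-g(A)=g_A^*(X-A)+(\text{terms of higher order})$ with $g^*_A\not\equiv0$. Set $$C^\ast_A:=\{B\in\mathcal M_n:(\sigma_1)_A^*(B)=0,\dots,(\sigma_n)_A^*(B)=0\}.$$ For $\lambda\in\mathbb D$ let $\Phi_\lambda(X):=(X-\lambda I)(I-\overline{\lambda}X)^{-1}$, $X\in\Omega_n$ (an automorphism of $\Omega_n$), with differential $(\Phi_\lambda)_{\ast,A}:\mathcal M_n\to\mathcal M_n$ at $A$. Finally $$C'_A:=\bigcap_{\lambda\in sp(A)}(\Phi_\lambda)_{\ast,A}^{-1}\bigl(C^\ast_{\Phi_{\lambda}(A)}\bigr).$$ *)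

(* Defs.v *)
(* The field of complex numbers is R[i] with R : realType; the notions that do
   not refer to R are defined over an arbitrary numClosedFieldType. *)
From mathcomp Require Export all_boot all_order all_algebra.
From mathcomp Require Export all_classical all_reals all_analysis.
From mathcomp Require Export complex.
(* The notations of mpoly clash with those of MathComp-Analysis. *)
From mathcomp.multinomials Require Import -(notations) mpoly.

Set Implicit Arguments.
Unset Strict Implicit.
Unset Printing Implicit Defensive.

Export Order.TTheory GRing.Theory Num.Theory numFieldNormedType.Exports.

Local Open Scope ring_scope.
Local Open Scope classical_set_scope.

Section Matrices.
Context {C : numClosedFieldType}.

Definition spectrum n (A : 'M[C]_n) : set C := [set l | eigenvalue A l].

Definition jordan_block (l : C) (k : nat) : 'M[C]_k :=
  \matrix_(i < k, j < k) (l *+ (i == j) + (i.+1 == j :> nat)%:R).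

(* A is similar to the block diagonal matrix whose i-th block is the nonempty
   Jordan block of size p i and eigenvalue l i. The change of basis P is square
   because it is both row free and row full, so that \sum_i p i = n. *)
Definition is_jordan_form n (A : 'M[C]_n)
    k (p : 'I_k -> nat) (l : 'I_k -> C) : Prop :=
  (forall i, (0 < p i)%N) /\
  exists P : 'M[C]_(\sum_(i < k) p i, n),
    [/\ row_free P, row_full P &
        P *m A = (\mxdiag_(i < k) jordan_block (l i) (p i)) *m P].

(* A Jordan form of A exists and is unique up to the order of the blocks, so
   quantifying over all of them amounts to considering any one of them. *)
Definition non_derogatory n (A : 'M[C]_n) : Prop :=
  forall k (p : 'I_k -> nat) (l : 'I_k -> C),
    is_jordan_form A p l -> injective l.

(* The indices are shifted by one: sigma_coord j is (-1)^(j+1) times the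
   coefficient of t^(n-(j+1)) in det(tI - A). *)
Definition sigma_coord n (j : 'I_n) (A : 'M[C]_n) : C :=
  (-1) ^+ j.+1 * (char_poly A)`_(n - j.+1)%N.

Definition sigma n (A : 'M[C]_n) : 'rV[C]_n := \row_(j < n) sigma_coord j A.

Definition ker_dsigma n (A : 'M[C]_n) : set 'M[C]_n :=
  [set B | 'd (@sigma n) A B = 0].

Definition unit_disc : set C := [set z | `|z| < 1].

(* phi is only relevant on D, which is meant to be open. *)
Definition holomorphic_on n (D : set C) (phi : C -> 'M[C]_n) : Prop :=
  forall z, D z -> derivable phi z 1.

(* The order of vanishing of f at 0 is at least m. *)
Definition vanishes_to_order n (m : nat) (f : C -> 'M[C]_n) : Prop :=
  forall k, (k < m)%N -> derive1n k f 0 = 0.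

(* The numbers alpha of which kobayashi below is the infimum modulus. *)
Definition kobayashi_admissible n (Omega : set 'M[C]_n) (A B : 'M[C]_n)
    (alpha : C) : Prop :=
  exists (m : nat) (phi : C -> 'M[C]_n),
    [/\ (1 <= m)%N,
        holomorphic_on unit_disc phi,
        forall z, unit_disc z -> Omega (phi z),
        vanishes_to_order m (fun z => phi z - A) &
        alpha *: derive1n m phi 0 = m`!%:R *: B].

(* The value at X of a polynomial in the n * n entries of a matrix. *)
Definition mxeval n (P : mpoly (n * n) C) (X : 'M[C]_n) : C :=
  meval (mxvec X 0) P.

(* P is a nonzero homogeneous polynomial of degree d > 0 such that
   g X - g A = P (X - A) + terms of order higher than d. *)
Definition is_lowest_form n (g : 'M[C]_n -> C) (A : 'M[C]_n)
    (P : mpoly (n * n) C) : Prop :=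
  exists d : nat,
    [/\ (0 < d)%N,
        P \is ishomog1 d mdeg,
        P != 0 &
        (fun X => g X - g A - mxeval P (X - A)) =o_A
          (fun X => `|X - A| ^+ d)].

(* Such a P exists and is unique if g is holomorphic and not constant near A;
   the default value 0 is never used for the functions sigma_coord j. *)
Definition lowest_form n (g : 'M[C]_n -> C) (A : 'M[C]_n) : mpoly (n * n) C :=
  xget 0 [set P | is_lowest_form g A P].

Definition Cstar n (A : 'M[C]_n) : set 'M[C]_n :=
  [set B | forall j : 'I_n, mxeval (lowest_form (sigma_coord j) A) B = 0].

Definition Phi n (l : C) (X : 'M[C]_n) : 'M[C]_n :=
  (X - l%:M) *m invmx (1%:M - l^* *: X).

Definition Cprime n (A : 'M[C]_n) : set 'M[C]_n :=
  \bigcap_(l in spectrum A) ('d (@Phi n l) A @^-1` Cstar (Phi l A)).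

End Matrices.

Section SpectralBall.
Context {R : realType}.

(* The modulus of a complex number as an element of R; the norm `|z| is the
   same number seen in R[i]. *)
Local Notation modulus := (@ComplexField.Normc.normc R).

(* The supremum is a maximum: the spectrum is finite, and nonempty if 0 < n. *)
Definition spectral_radius n (A : 'M[R[i]]_n) : R :=
  sup [set modulus l | l in spectrum A].

Definition spectral_ball n : set 'M[R[i]]_n := [set A | spectral_radius A < 1].

Definition non_derogatory_ball n : set 'M[R[i]]_n :=
  [set A | spectral_ball A /\ non_derogatory A].

(* The infimum is taken in \bar R, where that of the empty set is +oo. *)
Definition kobayashi n (Omega : set 'M[R[i]]_n) (A B : 'M[R[i]]_n) : \bar R :=
  ereal_inf [set (modulus alpha)%:E |
    alpha in kobayashi_admissible Omega A B].

End SpectralBall.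

(* Main.v *)
Require Import Defs.
From mathcomp.multinomials Require Import -(notations) mpoly.
From mathcomp Require Import ring lra zify.

(* Let Psi = Phi_lambda. For (i), if phi realises alpha then
   sigma_j (Psi (phi z)) - sigma_j (Psi A) has leading term
   alpha^-d P (dPsi B) z^(m d), where P is the lowest form, of degree d, of sigma_j
   at Psi A. As sigma_j is bounded on the spectral ball, the Cauchy estimates give
   |P (dPsi B)| <= C |alpha|^d with C independent of m, and alpha may be taken
   arbitrarily small. The Cauchy estimates come from Goursat's argument, carried
   out on Riemann sums over dyadic subdivisions, and hold for averages over 2^n-th
   roots of unity.

   For (ii), let lambda be an eigenvalue of A with z >= 2 Jordan blocks. Choose H
   that couples distinct blocks only: block-scalar conjugations show
   dsigma_A (H) = 0. Coupling the last row of each lambda-block with the first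
   columns of the others makes det (A - lambda + x H) = c x^z with c <> 0, while
   det (Phi_lambda A + x W) = O (x^z) for all W. So the lowest form of det at
   Phi_lambda A has degree z and does not vanish at dPhi_lambda (H). *)

Set Implicit Arguments.
Unset Strict Implicit.
Unset Printing Implicit Defensive.

Local Open Scope ring_scope.
Local Open Scope classical_set_scope.

(** * Limits and differentials of matrix-valued functions *)

Section MatrixLimits.
Context {C : numClosedFieldType}.

(** The pseudometric admits discs of every order [m] of contact, so an estimate that degrades with
    [m] would be lost in the infimum; this is why the Cauchy estimate is taken on a circle whose
    radius approaches 1 as the degree m d of the leading term grows. Orders of contact are expressed
    by iterated derivatives while holomorphy grants only one, so infinite differentiability has to
    be established before [phi - A] has a leading term at all. Moving lambda to 0 by [Phi] is what
    lets the determinant see the blocks of lambda, through its order of vanishing z. The coupling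
    direction is invisible to first order, each of its entries linking two different blocks, yet z
    >= 2 such blocks suffice for an invertible pattern with no diagonal entry. The inclusion of the
    kernel in C' is thus the one that fails. *)

Lemma mx_entry_le m n (M : 'M[C]_(m, n)) i j : `|M i j| <= `|M|.
Proof.
rewrite [leRHS]mx_normE -[leLHS]nngE num_le.
exact: (le_bigmax _ (fun k : 'I_m * 'I_n => `|M k.1 k.2|%:nng) (i, j)).
Qed.

Lemma cvg_mx_entries (T : Type) (F : set_system T) {FF : Filter F} m n
    (f : T -> 'M[C]_(m, n)) (M : 'M[C]_(m, n)) :
  (forall i j, f x i j @[x --> F] --> M i j) -> f x @[x --> F] --> M.
Proof.
move=> H; apply/cvgrPdist_lt => e e0.
have : \forall x \near F, forall i, forall j, `|M i j - f x i j| < e.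
  apply: filter_forall => i; apply: filter_forall => j.
  by have /cvgrPdist_lt/(_ e e0) := H i j.
apply: filterS => x Hx.
have : ball M e (f x) by split.
by rewrite mx_norm_ball.
Qed.

Lemma cvg_mx_entry (T : Type) (F : set_system T) {FF : Filter F} m n
    (f : T -> 'M[C]_(m, n)) (M : 'M[C]_(m, n)) i j :
  f x @[x --> F] --> M -> f x i j @[x --> F] --> M i j.
Proof. by move=> H; exact: (cvg_comp _ _ H (@coord_continuous C m n i j M)). Qed.

Lemma differentiable_mx_entries (V : normedModType C) m n (f : V -> 'M[C]_(m, n)) x :
  (forall i j, differentiable (fun v => f v i j : C) x) -> differentiable f x.
Proof.
move=> H.
have -> : f = \sum_(i < m) \sum_(j < n) (fun v => f v i j *: delta_mx i j).
  apply/funext => v; rewrite [LHS]matrix_sum_delta fct_sumE.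
  by apply: eq_bigr => i _; rewrite fct_sumE.
apply: differentiable_sum => i; apply: differentiable_sum => j.
exact: differentiableZl.
Qed.

Lemma is_derive_mx_entry m n (f : C -> 'M[C]_(m, n)) z i j :
  derivable f z 1 -> is_derive z 1 (fun w => f w i j : C) (f^`()%classic z i j).
Proof.
move=> df; have df1 := (derivable1_diffP _ _).1 df.
have dc := differentiable_coord (f z) i j.
have dcf : differentiable ((fun M : 'M[C]_(m, n) => M i j : C) \o f) z.
  exact: differentiable_comp.
apply: DeriveDef; first by apply/derivable1_diffP.
rewrite derive1E.
have H : h^-1 *: ((f \o shift z) (h *: 1) - f z) @[h --> 0^'] --> 'D_1 f z := df.
have := cvg_mx_entry (i := i) (j := j) H => {}H.
apply/cvg_lim => //.
suff -> : (fun h => h^-1 *: (((fun w => f w i j : C) \o shift z) (h *: 1) - f z i j)) =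
    (fun h => (h^-1 *: ((f \o shift z) (h *: 1) - f z)) i j).
  by exact: H.
by apply/funext => h; rewrite !mxE.
Qed.

(** The direction [u x] may vary and [t x] is arbitrary: this lets [t] be a power [z ^+ m] and [u]
    the rescaled increment of a disc. The linear part of the quotient is exactly ['d g A (u x)], and
    [u] stays bounded, so the remainder is negligible against [t]. *)
Lemma cvg_diff_quotient (V W : normedModType C) (g : V -> W) (A v : V)
    (T : Type) (F : set_system T) {FF : ProperFilter F} (t : T -> C) (u : T -> V) :
  differentiable g A -> t x @[x --> F] --> 0 -> u x @[x --> F] --> v ->
  (\forall x \near F, t x != 0) ->
  (t x)^-1 *: (g (A + t x *: u x) - g A) @[x --> F] --> 'd g A v.
Proof.
move=> dg t0 uv tn0.
have tu0 : t x *: u x @[x --> F] --> (0 : V).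
  by rewrite -(scale0r v); apply: cvgZ.
have du : 'd g A (u x) @[x --> F] --> 'd g A v.
  by apply: cvg_comp uv _; apply: diff_continuous.
rewrite -[X in _ --> X]addr0.
have E : \forall x \near F, 
    'd g A (u x) + (t x)^-1 *: (g (A + t x *: u x) - g A - 'd g A (t x *: u x)) =
   (t x)^-1 *: (g (A + t x *: u x) - g A).
  apply: filterS tn0 => x tx; rewrite linearZ /= scalerBr.
  by rewrite scalerA mulVf // scale1r addrC subrK.
apply: cvg_trans (near_eq_cvg E) _; apply: cvgD => //.
apply/cvgrPdist_le => e e0.
have Ku : \forall x \near F, `|u x| <= `|v| + 1.
  have /cvgrPdist_le /(_ 1 ltr01) := uv; apply: filterS => x H.
  rewrite -[u x](subrK v); apply: le_trans (ler_normD _ _) _.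
  by rewrite addrC lerD2l distrC.
have K0 : 0 < `|v| + 1 by rewrite ltr_wpDl.
have /eqaddoP Ho := diff_locally dg.
have e'0 : 0 < e / (`|v| + 1) by rewrite divr_gt0.
have Hn : \forall x \near F, `|g (A + t x *: u x) - g A - 'd g A (t x *: u x)| <=
    e / (`|v| + 1) * `|t x *: u x|.
  have : \forall x \near F, `|(g \o shift A - (cst (g A) + 'd g A)) (t x *: u x)| <=
      e / (`|v| + 1) * `|id (t x *: u x)| := tu0 _ (Ho _ e'0).
  apply: filterS => x Hx; apply: le_trans Hx.
  by rewrite /= !fctE /= opprD addrA (addrC A).
near=> x.
rewrite sub0r normrN normrZ normfV.
have tx : t x != 0 by near: x.
rewrite mulrC ler_pdivrMr ?normr_gt0 //.
apply: le_trans (_ : e / (`|v| + 1) * `|t x *: u x| <= _); first by near: x.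
rewrite normrZ mulrA mulrAC -ler_pdivlMr ?normr_gt0 // mulfK ?normr_eq0 //.
rewrite mulrAC ler_pdivrMr // ler_pM2l //; near: x; exact: Ku.
Unshelve. all: by end_near. Qed.
End MatrixLimits.

(** * Lowest homogeneous forms *)

(** The lowest digit is the residue modulo [D]; the others follow by induction after division by
    [D]. Digits are functions on [nat], so that the shift needs no ordinals. *)
Lemma base_expansion_inj D n (f g : nat -> nat) :
  (forall i, (i < n)%N -> (f i < D)%N) -> (forall i, (i < n)%N -> (g i < D)%N) ->
  (\sum_(i < n) f i * D ^ i = \sum_(i < n) g i * D ^ i)%N ->
  forall i, (i < n)%N -> f i = g i.
Proof.
elim: n f g => [//|n IH] f g fD gD.
rewrite !big_ord_recl /= expn0 !muln1.
have D0 : (0 < D)%N by have := fD 0%N isT; case: (D).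
have sumE (h : nat -> nat) :
    (\sum_(i < n) h (bump 0 i) * D ^ bump 0 i = (\sum_(i < n) h i.+1 * D ^ i) * D)%N.
  by rewrite big_distrl; apply: eq_bigr => i _; rewrite /bump add1n expnS mulnA mulnAC.
rewrite !sumE => E.
have f0 : f 0%N = g 0%N.
  have /(congr1 (modn^~ D)) := E; rewrite ![(_ + _ * D)%N]addnC !modnMDl.
  by rewrite !modn_small ?fD ?gD.
move: E; rewrite f0 => /addnI /eqP; rewrite eqn_pmul2r // => /eqP H [//|i] iD.
exact: (IH (fun i => f i.+1) (fun i => g i.+1) (fun i iD => fD i.+1 iD)
  (fun i iD => gD i.+1 iD) H).
Qed.

Section MatrixPolynomials.
Context {C : numClosedFieldType}.

(* Substituting t ^ (D ^ i) for the i-th variable, with D larger than all exponents,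
   sends distinct monomials to distinct powers of t. *)
Lemma mpoly_eval_neq0 n (p : mpoly n C) : p != 0 -> exists v, meval v p != 0.
Proof.
move=> p0.
have [m0 m0p] : exists m0, m0 \in msupp p.
  move: p0; rewrite -msupp_eq0; case: (msupp p) => [//|m s _].
  by exists m; rewrite inE eqxx.
pose D := (\max_(m <- msupp p) mdeg m).+1.
have mD m (i : 'I_n) : m \in msupp p -> (m i < D)%N.
  move=> mp; rewrite ltnS; apply: leq_trans (leq_bigmax_seq _ mp _) => //.
  by rewrite mdegE (bigD1 i) //= leq_addr.
pose e (m : multinom n) := (\sum_(i < n) m i * D ^ i)%N.
have e_inj m m' : m \in msupp p -> m' \in msupp p -> e m = e m' -> m = m'.
  move=> mp m'p em; apply/mnmP => i.
  pose ext (m1 : multinom n) k := oapp (fun j : 'I_n => m1 j) 0%N (insub k).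
  have extE m1 (j : 'I_n) : ext m1 j = m1 j by rewrite /ext valK.
  have extD m1 k : m1 \in msupp p -> (k < n)%N -> (ext m1 k < D)%N.
    by move=> m1p kn; rewrite -[k]/(val (Ordinal kn)) extE mD.
  rewrite -!extE; apply: (@base_expansion_inj D n) => //; try by move=> k; apply: extD.
  have sE m1 : (\sum_(j < n) ext m1 j * D ^ j)%N = e m1.
    by apply: eq_bigr => j _; rewrite extE.
  by rewrite !sE.
pose q : {poly C} := \sum_(m <- msupp p) (mcoeff m p)%:P * 'X^(e m).
have q0 : q != 0.
  apply/eqP => /(congr1 (coefp (e m0))) /=; rewrite coef0 coef_sum.
  rewrite (bigD1_seq m0) ?msupp_uniq //= coefCM coefXn eqxx mulr1.
  rewrite big_seq_cond big1 ?addr0 => [/eqP|m /andP[mp mm0]].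
    by rewrite mcoeff_eq0 m0p.
  rewrite coefCM coefXn; case: eqP => [/(e_inj _ _ m0p mp) E|_]; last by rewrite mulr0.
  by rewrite E eqxx in mm0.
have [t qt] : exists t, q.[t] != 0.
  apply: contrapT => H; move/negP: q0; apply.
  apply/eqP/(@roots_geq_poly_eq0 _ _ [seq k%:R | k <- iota 0 (size q)]).
  - apply/allP => _ /mapP[k _ ->]; apply/eqP; apply: contrapT => Hk; apply: H.
    by exists k%:R; apply/eqP.
  - rewrite map_inj_uniq ?iota_uniq // => i j /eqP; rewrite eqr_nat; exact: eqP.
  - by rewrite size_map size_iota.
exists (fun i : 'I_n => t ^+ (D ^ i)); rewrite mevalE.
move: qt; congr (_ != _); rewrite horner_sum; apply: eq_bigr => m _.
rewrite hornerM hornerC hornerXn; congr (_ * _).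
rewrite /e -prodrXr; apply: eq_bigr => i _; rewrite -exprM mulnC //.
Qed.

Lemma mxeval_neq0 n (P : mpoly (n * n) C) : P != 0 -> exists X, mxeval P X != 0.
Proof.
move=> /mpoly_eval_neq0[v vP]; exists (vec_mx (\row_k v k)).
by rewrite /mxeval vec_mxK (@meval_eq _ _ _ v) // => k; rewrite mxE.
Qed.

Lemma mxevalE n (P : mpoly (n * n) C) X :
  mxeval P X = \sum_(m <- msupp P) mcoeff m P * \prod_i mxvec X 0 i ^+ m i.
Proof. exact: mevalE. Qed.

Lemma mxeval_homog n d (P : mpoly (n * n) C) (t : C) X : P \is ishomog1 d mdeg ->
  mxeval P (t *: X) = t ^+ d * mxeval P X.
Proof.
move=> /dhomogP Pd; rewrite !mxevalE mulr_sumr [LHS]big_seq [RHS]big_seq.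
apply: eq_bigr => m /Pd /= <-; rewrite mulrCA; congr (_ * _).
rewrite mdegE -prodrXr -big_split /=; apply: eq_bigr => i _.
by rewrite linearZ /= mxE exprMn.
Qed.

Lemma differentiable_prod_seq (V : normedModType C) (I : Type) (r : seq I)
    (f : I -> V -> C) x : (forall i, differentiable (f i) x) ->
  differentiable (fun v => \prod_(i <- r) f i v) x.
Proof.
move=> df; elim: r => [|i r IH].
  under eq_fun do rewrite big_nil; exact: differentiable_cst.
under eq_fun do rewrite big_cons; exact: differentiableM.
Qed.

Lemma differentiable_sum_seq (V W : normedModType C) (I : Type) (r : seq I)
    (f : I -> V -> W) x : (forall i, differentiable (f i) x) ->
  differentiable (fun v => \sum_(i <- r) f i v) x.
Proof.
move=> df; elim: r => [|i r IH].
  under eq_fun do rewrite big_nil; exact: differentiable_cst.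
under eq_fun do rewrite big_cons; exact: differentiableD.
Qed.

Lemma differentiable_mxeval n (P : mpoly (n * n) C) X :
  differentiable (mxeval P : 'M[C]_n -> C) X.
Proof.
have -> : (mxeval P : 'M[C]_n -> C) = fun X =>
    \sum_(m <- msupp P) mcoeff m P * \prod_i mxvec X 0 i ^+ m i.
  by apply/funext => Y; exact: mxevalE.
apply: differentiable_sum_seq => m.
apply: (@differentiableM _ _ (fun=> mcoeff m P)); first exact: differentiable_cst.
apply: differentiable_prod_seq => k.
have df : differentiable (fun v : 'M[C]_n => mxvec v 0 k : C) X.
  case: (mxvec_indexP k) => i j.
  have -> : (fun v : 'M[C]_n => mxvec v 0 (mxvec_index i j)) = (fun v => v i j).
    by apply/funext => v; rewrite mxvecE.
  exact: differentiable_coord.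
elim: (m k) => [|d IH].
  under eq_fun do rewrite expr0; exact: differentiable_cst.
by under eq_fun do rewrite exprS; exact: differentiableM.
Qed.

Lemma mxvec_entry_le m n (X : 'M[C]_(m, n)) k : `|mxvec X 0 k| <= `|X|.
Proof. by case: (mxvec_indexP k) => i j; rewrite mxvecE mx_entry_le. Qed.

(** Counterpart of [cvg_diff_quotient] in degree [d]: by homogeneity the polynomial part of the
    quotient is exactly [mxeval P (u x)]. *)
Lemma cvg_lowest_quotient n (g : 'M[C]_n -> C) (A v : 'M[C]_n) P d
    (T : Type) (F : set_system T) {FF : ProperFilter F} (t : T -> C) (u : T -> 'M[C]_n) :
  P \is ishomog1 d mdeg ->
  (fun X => g X - g A - mxeval P (X - A)) =o_A (fun X => `|X - A| ^+ d) ->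
  t x @[x --> F] --> 0 -> u x @[x --> F] --> v -> (\forall x \near F, t x != 0) ->
  (t x ^+ d)^-1 * (g (A + t x *: u x) - g A) @[x --> F] --> mxeval P v.
Proof.
move=> Pd /eqoP Ho t0 uv tn0.
have tuA : A + t x *: u x @[x --> F] --> (A : 'M[C]_n).
  rewrite -[X in _ --> X]addr0 -(scale0r v).
  by apply: cvgD; [exact: cvg_cst|apply: cvgZ].
have Pu : mxeval P (u x) @[x --> F] --> mxeval P v.
  by apply: cvg_comp uv _; apply: differentiable_continuous; apply: differentiable_mxeval.
rewrite -[X in _ --> X]addr0.
pose rem X := g X - g A - mxeval P (X - A).
have dE x : A + t x *: u x - A = t x *: u x by rewrite addrC addKr.
have E : \forall x \near F, mxeval P (u x) + (t x ^+ d)^-1 * rem (A + t x *: u x) =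
   (t x ^+ d)^-1 * (g (A + t x *: u x) - g A).
  apply: filterS tn0 => x tx; rewrite /rem dE.
  rewrite (mxeval_homog _ _ Pd) mulrBr.
  by rewrite [X in _ - X]mulKf ?expf_neq0 // addrC subrK.
apply: cvg_trans (near_eq_cvg E) _; apply: cvgD => //.
apply/cvgrPdist_le => e e0.
have Ku : \forall x \near F, `|u x| <= `|v| + 1.
  have /cvgrPdist_le /(_ 1 ltr01) := uv; apply: filterS => x H.
  rewrite -[u x](subrK v); apply: le_trans (ler_normD _ _) _.
  by rewrite addrC lerD2l distrC.
have K0 : 0 < `|v| + 1 by rewrite ltr_wpDl.
have Kd : 0 < (`|v| + 1) ^+ d by rewrite exprn_gt0.
have e'0 : 0 < e / (`|v| + 1) ^+ d by rewrite divr_gt0.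
have Hn : \forall x \near F, `|rem (A + t x *: u x)| <=
    e / (`|v| + 1) ^+ d * (`|t x| * `|u x|) ^+ d.
  have : \forall x \near F, `|rem (A + t x *: u x)| <=
      e / (`|v| + 1) ^+ d * `| `|A + t x *: u x - A| ^+ d |
    := tuA _ (Ho _ e'0).
  apply: filterS => x; rewrite dE normrX normr_id normrZ.
  by [].
near=> x.
have tx : t x != 0 by near: x.
rewrite sub0r normrN normrM normfV normrX mulrC ler_pdivrMr ?exprn_gt0 ?normr_gt0 //.
apply: le_trans (_ : e / (`|v| + 1) ^+ d * (`|t x| * `|u x|) ^+ d <= _); first by near: x.
rewrite exprMn mulrA mulrAC ler_pM2r ?exprn_gt0 ?normr_gt0 //.
rewrite mulrAC ler_pdivrMr // ler_pM2l // lerXn2r ?nnegrE //; near: x.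
Unshelve. all: by end_near. Qed.

End MatrixPolynomials.

Section LowestForms.
Context {C : numClosedFieldType}.

Lemma norm_mxeval_le n (P : mpoly (n * n) C) d (X : 'M[C]_n) : `|X| <= 1 ->
  (forall m, m \in msupp P -> (d <= mdeg m)%N) ->
  `|mxeval P X| <= (\sum_(m <- msupp P) `|mcoeff m P|) * `|X| ^+ d.
Proof.
move=> X1 Pd; rewrite mxevalE mulr_suml; apply: le_trans (ler_norm_sum _ _ _) _.
rewrite big_seq [leRHS]big_seq; apply: ler_sum => m mP.
rewrite normrM ler_wpM2l // normr_prod.
apply: le_trans (_ : `|X| ^+ mdeg m <= _); last by apply: ler_wiXn2l => //; exact: Pd.
rewrite mdegE -prodrXr; apply: ler_prod => i _; rewrite normr_ge0 normrX /=.
by apply: lerXn2r; rewrite ?nnegrE // mxvec_entry_le.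
Qed.

(** The Taylor expansion of the polynomial [S] at [A] is again a polynomial [Q], in the increment,
    obtained by substitution; its homogeneous component of least degree is the lowest form. The
    value at [X0] makes [Q] nonzero. *)
Lemma exists_lowest_form n (S : mpoly (n * n) C) (A X0 : 'M[C]_n) :
  mxeval S X0 != mxeval S A -> exists P, is_lowest_form (mxeval S) A P.
Proof.
move=> SX0.
pose Q : mpoly (n * n) C :=
  comp_mpoly [tuple @mpolyX _ _ (mnm1 k) + mpolyC _ (mxvec A 0 k) | k < n * n] S -
  mpolyC _ (mxeval S A).
have QE X : mxeval Q X = mxeval S (A + X) - mxeval S A.
  rewrite /Q {1}/mxeval mevalB mevalC comp_mpoly_meval; congr (_ - _).
  rewrite /mxeval; apply: meval_eq => k.
  by rewrite tnth_mktuple mevalD mevalXU mevalC linearD /= mxE addrC.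
have Q0 : Q != 0.
  apply: contra_neq SX0 => Q0; have := QE (X0 - A).
  by rewrite Q0 {1}/mxeval meval0 [A + _]addrC subrK => /esym/eqP; rewrite subr_eq0 => /eqP.
have exd : exists d, has (fun m => mdeg m == d) (msupp Q).
  move: Q0; rewrite -msupp_eq0; case E : (msupp Q) => [//|m s] _.
  by exists (mdeg m); rewrite /= eqxx.
pose d := ex_minn exd; pose P := pihomog mdeg d Q.
have dmin m : m \in msupp Q -> (d <= mdeg m)%N.
  move=> mQ; rewrite /d; case: ex_minnP => d' _ min; apply: min.
  by apply/hasP; exists m.
have [m0 m0Q m0d] : exists2 m, m \in msupp Q & mdeg m = d.
  by rewrite /d; case: ex_minnP => d' /hasP[m mQ /eqP md] _; exists m.
have Pcoef m : mcoeff m P = if mdeg m == d then mcoeff m Q else 0.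
  rewrite /P pihomogE raddf_sum /=.
  have E m' : mcoeff m (mcoeff m' Q *: mpolyX C m') = if m' == m then mcoeff m Q else 0.
    by rewrite mcoeffZ mcoeffX; case: eqVneq => [->|]; rewrite ?mulr1 ?mulr0.
  case: ifPn => [/eqP md|/negPf md].
    rewrite [in RHS](mpolyE Q) raddf_sum big_mkcond /=; apply: eq_bigr => m' _.
    rewrite !E; case: (eqVneq m' m) => [->|_]; first by rewrite md eqxx.
    by rewrite if_same.
  rewrite big1 // => m' /eqP m'd; rewrite E.
  by case: eqP => // mm; rewrite -mm m'd eqxx in md.
have Q00 : mxeval Q 0 = 0 by rewrite QE addr0 subrr.
(* The only monomial of degree 0 is the constant one, whose coefficient is the value of [Q] at 0,
   that is 0. *)
have d0 : (0 < d)%N.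
  rewrite lt0n; apply/eqP => d0; move: Q00; rewrite mxevalE.
  have term (m : multinom (n * n)) : \prod_i mxvec (0 : 'M[C]_n) 0 i ^+ m i = 0 ^+ mdeg m.
    by rewrite mdegE -prodrXr; apply: eq_bigr => i _; rewrite linear0 mxE.
  under eq_bigr do rewrite term.
  rewrite (bigD1_seq m0) ?msupp_uniq //= m0d d0 expr0 mulr1 big1 ?addr0 => [/eqP|m mm0].
    by rewrite mcoeff_eq0 m0Q.
  rewrite expr0n; case: eqP => [/eqP|_]; last by rewrite mulr0.
  rewrite mdeg_eq0 => /eqP mE; have /eqP := m0d; rewrite d0 mdeg_eq0 => /eqP m0E.
  by rewrite mE m0E eqxx in mm0.
exists P, d; split => //.
- exact: pihomogP.
- apply/eqP => /(congr1 (mcoeff m0)); rewrite Pcoef m0d eqxx mcoeff0 => /eqP.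
  by rewrite mcoeff_eq0 m0Q.
have rem_d m : m \in msupp (Q - P) -> (d.+1 <= mdeg m)%N.
  rewrite mcoeff_msupp mcoeffB Pcoef; case: (eqVneq (mdeg m) d) => [_|md].
    by rewrite subrr eqxx.
  rewrite subr0 -mcoeff_msupp => /dmin; lia.
apply/eqoP => e e0.
pose K := \sum_(m <- msupp (Q - P)) `|mcoeff m (Q - P)|.
have K0 : 0 < K + 1 by rewrite ltr_wpDl ?sumr_ge0.
have near_le (r : C) : 0 < r -> \forall X \near A, `|X - A| <= r.
  move=> r0; have /cvgrPdist_le /(_ r r0) := @cvg_id _ (nbhs A).
  by apply: filterS => X; rewrite distrC.
near=> X.
have -> : mxeval S X - mxeval S A - mxeval P (X - A) = mxeval (Q - P) (X - A).
  rewrite [RHS](_ : _ = mxeval Q (X - A) - mxeval P (X - A)); last exact: mevalB.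
  by rewrite QE [A + _]addrC subrK.
have X1 : `|X - A| <= 1 by near: X; exact: near_le.
have Xe : `|X - A| <= e / (K + 1) by near: X; apply: near_le; rewrite divr_gt0.
apply: le_trans (norm_mxeval_le X1 rem_d) _.
rewrite normrX normr_id exprSr mulrA mulrC -/K mulrA; apply: ler_wpM2r; first by rewrite exprn_ge0.
apply: le_trans (_ : e / (K + 1) * (K + 1) <= _); last by rewrite divfK // gt_eqF.
by apply: ler_pM => //; [apply: sumr_ge0|rewrite lerDl].
Unshelve. all: by end_near. Qed.

(** The characteristic polynomial is that of the generic matrix, whose entries are the variables. *)
Definition sigma_poly n (j : 'I_n) : mpoly (n * n) C :=
  (-1) ^+ j.+1 *
  (char_poly (\matrix_(i, k) @mpolyX (n * n) C (mnm1 (mxvec_index i k))))`_(n - j.+1).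

Lemma sigma_polyE n (j : 'I_n) (X : 'M[C]_n) :
  sigma_coord j X = mxeval (sigma_poly j) X.
Proof.
rewrite /mxeval /sigma_poly mevalM rmorphXn rmorphN1; congr (_ * _).
rewrite -coef_map map_char_poly; congr ((char_poly _)`_ _).
by apply/matrixP => i k; rewrite !mxE /= mevalXU mxvecE.
Qed.

Lemma differentiable_sigma_coord n (j : 'I_n) X :
  differentiable (sigma_coord j : 'M[C]_n -> C) X.
Proof.
have -> : (sigma_coord j : 'M[C]_n -> C) = mxeval (sigma_poly j).
  by apply/funext => Y; exact: sigma_polyE.
exact: differentiable_mxeval.
Qed.

Lemma differentiable_sigma n X : differentiable (@sigma C n) X.
Proof.
apply: differentiable_mx_entries => i j.
have -> : (fun v : 'M[C]_n => sigma v i j) = sigma_coord j.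
  by apply/funext => v; rewrite mxE.
exact: differentiable_sigma_coord.
Qed.

Lemma differentiable_det n X : differentiable (fun Y : 'M[C]_n => \det Y : C) X.
Proof.
apply: differentiable_sum_seq => s.
apply: (@differentiableM _ _ (fun=> _)); first exact: differentiable_cst.
apply: differentiable_prod_seq => i; exact: differentiable_coord.
Qed.

End LowestForms.

(** * The automorphisms of the spectral ball *)

Section Automorphisms.
Context {C : numClosedFieldType}.

(** Meant for [invmx], which is defined by cases: it agrees with the adjugate formula only on a
    neighbourhood of an invertible matrix. *)
Lemma near_eq_differentiable (V W : normedModType C) (f g : V -> W) x :
  (\forall y \near x, f y = g y) -> differentiable g x -> differentiable f x.
Proof.
move=> fg dg.
have fgx : f x = g x := nbhs_singleton fg.
have H : f \o shift x = cst (f x) + 'd g x +o_ 0 id.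
  apply/eqaddoP => e e0; have /eqaddoP /(_ e e0) := diff_locally dg.
  have : \forall h \near (0 : V), f (h + x) = g (h + x).
    have : h + x @[h --> (0 : V)] --> x.
      by rewrite -[X in _ --> X]add0r; apply: cvgD; [exact: cvg_id|exact: cvg_cst].
    by move/(_ _ fg).
  by apply: filterS2 => h E; rewrite !fctE /= E fgx.
have dgc : continuous ('d g x) by exact: diff_continuous.
apply/diff_locallyP; rewrite (diff_unique dgc H).
by split.
Qed.

(** Each factor ['X - a%:P] with [a] in the closed unit disc at most doubles a bound on the
    coefficients. Any bound that depends on the number of factors alone would do. *)
Lemma norm_coef_prod_le (rs : seq C) k : (forall a, a \in rs -> `|a| <= 1) ->
  `|(\prod_(a <- rs) ('X - a%:P))`_k| <= 2 ^+ size rs.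
Proof.
elim: rs k => [|a rs IH] k rs1.
  by rewrite big_nil expr0 coef1; case: (k == 0)%N; rewrite ?normr1 ?normr0.
have {}IH k' : `|(\prod_(a <- rs) ('X - a%:P))`_k'| <= 2 ^+ size rs.
  by apply: IH => b brs; apply: rs1; rewrite inE brs orbT.
rewrite big_cons mulrBl coefB coefXM coefCM exprS.
apply: le_trans (ler_normB _ _) _; rewrite mulr2n mulrDl mul1r.
apply: lerD; first by case: (k == 0)%N => //; rewrite normr0 exprn_ge0.
rewrite normrM -[leRHS]mul1r; apply: ler_pM => //.
by apply: rs1; rewrite inE eqxx.
Qed.

Lemma norm_sigma_coord_le n (j : 'I_n) (X : 'M[C]_n) :
  (forall a, eigenvalue X a -> `|a| <= 1) -> `|sigma_coord j X| <= 2 ^+ n.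
Proof.
move=> X1; have [rs E] := closed_field_poly_normal (char_poly X).
rewrite (monicP (char_poly_monic X)) scale1r in E.
have srs : size rs = n.
  by have := size_char_poly X; rewrite E size_prod_XsubC => -[].
rewrite /sigma_coord normrM normrX normrN1 expr1n mul1r E -[in leRHS]srs.
apply: norm_coef_prod_le => a ars; apply: X1.
by rewrite eigenvalue_root_char E root_prod_XsubC.
Qed.

Lemma unitmx_sub_scale n (X : 'M[C]_n) (l : C) : `|l| < 1 ->
  (forall a, eigenvalue X a -> `|a| < 1) -> 1%:M - l *: X \in unitmx.
Proof.
move=> l1 X1; rewrite unitmxE unitfE; apply/det0P => -[v v0].
rewrite mulmxBr mulmx1 -scalemxAr => /eqP; rewrite subr_eq0 => /eqP E.
have l0 : l != 0 by apply: contra_neq v0 => l0; rewrite E l0 scale0r.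
have : eigenvalue X l^-1.
  by apply/eigenvalueP; exists v => //; rewrite [in RHS]E scalerA mulVf // scale1r.
move=> /X1; rewrite normfV invf_lt1 ?normr_gt0 // => /(lt_trans l1).
by rewrite ltxx.
Qed.

(** An eigenvector of [Phi l X] for [a] is one of [X] for the Moebius preimage (a + l) / (1 + a l'),
    where l' is the conjugate of l. The conclusion follows from |1 + a l'|^2 - |a + l|^2 = (1 -
    |l|^2) (1 - |a|^2). *)
Lemma eigenvalue_Phi n (X : 'M[C]_n) (l : C) a : `|l| < 1 ->
  (forall b, eigenvalue X b -> `|b| < 1) -> eigenvalue (Phi l X) a -> `|a| < 1.
Proof.
move=> l1 X1 /eigenvalueP [v E v0].
have lc1 : `|l^*| < 1 by rewrite norm_conjC.
have MU := unitmx_sub_scale lc1 X1; set M := 1%:M - _ in MU.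
have E1 : v *m (X - l%:M) = a *: (v *m M).
  rewrite -[LHS]mulmx1 -(mulVmx MU) mulmxA -[v *m _ *m _]mulmxA -/(Phi l X).
  by rewrite E -scalemxAl.
have E2 : (1 + a * l^*) *: (v *m X) = (a + l) *: v.
  move: E1; rewrite mulmxBr mul_mx_scalar mulmxBr mulmx1 -scalemxAr scalerBr scalerA.
  by move=> /(canRL (subrK _)) {}E1; rewrite scalerDl scale1r {1}E1 scalerDl addrAC subrK.
have ll : l * l^* < 1 by rewrite -normCK expr_lt1.
have D0 : 1 + a * l^* != 0.
  apply/eqP => D0; move/eqP: E2; rewrite D0 scale0r eq_sym scaler_eq0 (negPf v0) orbF.
  rewrite addr_eq0 => /eqP al; move: D0; rewrite al mulNr => /eqP.
  by rewrite subr_eq0 => /eqP E3; rewrite -E3 ltxx in ll.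
have : eigenvalue X ((a + l) / (1 + a * l^*)).
  apply/eigenvalueP; exists v => //.
  by rewrite mulrC -scalerA -E2 scalerA mulVf // scale1r.
move=> /X1; rewrite normrM normfV ltr_pdivrMr ?normr_gt0 // mul1r => H.
have : `|a + l| ^+ 2 < `|1 + a * l^*| ^+ 2 by rewrite ltrXn2r.
rewrite !normCK.
have -> : (1 + a * l^*)^* = 1 + a^* * l by rewrite rmorphD rmorph1 rmorphM /= conjCK.
have -> : (a + l)^* = a^* + l^* by rewrite rmorphD.
rewrite -subr_gt0.
have -> : (1 + a * l^*) * (1 + a^* * l) - (a + l) * (a^* + l^*) =
  (1 - l * l^*) * (1 - a * a^*) by ring.
rewrite pmulr_rgt0 ?subr_gt0 // -normCK.
by rewrite expr_lt1.
Qed.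

Lemma near_unitmx n (M : 'M[C]_n -> 'M[C]_n) X : differentiable M X ->
  M X \in unitmx -> \forall Y \near X, M Y \in unitmx.
Proof.
move=> dM; rewrite unitmxE unitfE => MX.
have c : (\det (M Y) : C) @[Y --> X] --> (\det (M X) : C).
  have c1 : M Y @[Y --> X] --> M X := differentiable_continuous dM.
  have c2 : (\det Y : C) @[Y --> M X] --> (\det (M X) : C) :=
    differentiable_continuous (differentiable_det (M X)).
  exact: (cvg_comp _ _ c1 c2).
have e0 : 0 < `|\det (M X)| by rewrite normr_gt0.
have /cvgrPdist_lt /(_ _ e0) := c.
apply: filterS => Y; rewrite unitmxE unitfE; apply: contraTneq => ->.
by rewrite subr0 ltxx.
Qed.

Lemma differentiable_mulmx (V : normedModType C) m n p (f : V -> 'M[C]_(m, n))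
    (g : V -> 'M[C]_(n, p)) x :
  differentiable f x -> differentiable g x -> differentiable (fun v => f v *m g v) x.
Proof.
move=> df dg; apply: differentiable_mx_entries => i k.
under eq_fun do rewrite mxE.
apply: differentiable_sum_seq => j; apply: differentiableM.
  exact: (differentiable_comp df (differentiable_coord _ _ _)).
exact: (differentiable_comp dg (differentiable_coord _ _ _)).
Qed.

Lemma differentiable_invmx n (X : 'M[C]_n) : X \in unitmx ->
  differentiable (@invmx _ n : 'M[C]_n -> 'M[C]_n) X.
Proof.
move=> XU; apply: (@near_eq_differentiable _ _ _ (fun Y : 'M[C]_n => (\det Y)^-1 *: \adj Y)).
  have : \forall Y \near X, Y \in unitmx by apply: (@near_unitmx n id).
  by apply: filterS => Y; rewrite /invmx => ->.
apply: differentiable_mx_entries => i k.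
under eq_fun do rewrite !mxE.
apply: differentiableM.
  by apply: differentiableV; [exact: differentiable_det|rewrite -unitfE -unitmxE].
apply: (@differentiableM _ _ (fun=> _)); first exact: differentiable_cst.
have dm : differentiable (fun Y : 'M[C]_n => row' k (col' i Y) : 'M[C]_n.-1) X.
  apply: differentiable_mx_entries => a b; under eq_fun do rewrite !mxE.
  exact: differentiable_coord.
exact: (differentiable_comp dm (differentiable_det _)).
Qed.

Lemma differentiable_Phi n (l : C) (X : 'M[C]_n) : 1%:M - l^* *: X \in unitmx ->
  differentiable (@Phi C n l) X.
Proof.
move=> MU; apply: differentiable_mulmx.
  apply: (@differentiableB _ _ _ id (fun=> l%:M)); [exact: ex_diff|exact: differentiable_cst].
have dM : differentiable (fun Y : 'M[C]_n => 1%:M - l^* *: Y) X.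
  apply: (@differentiableB _ _ _ (fun=> 1%:M)); first exact: differentiable_cst.
  apply: (@differentiableZ _ _ _ id); exact: ex_diff.
exact: (differentiable_comp dM (differentiable_invmx MU)).
Qed.

End Automorphisms.

(** * Derogatory matrices in Jordan form *)

Section Derogatory.
Context {C : numClosedFieldType}.

(** Block coordinates: [tagnat.sig1] is the block of a row, [tagnat.sig2] its position there. The
    arguments below use this formula with abstract maps [blk] and [pos], which keeps dependent types
    out of them. *)
Lemma jordan_mxdiagE k (p : 'I_k -> nat) (l : 'I_k -> C) (a b : 'I_(\sum_(i < k) p i)) :
  (\mxdiag_(i < k) jordan_block (l i) (p i)) a b =
  if tagnat.sig1 a == tagnat.sig1 b then
    l (tagnat.sig1 a) *+ (tagnat.sig2 a == tagnat.sig2 b :> nat) +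
    ((tagnat.sig2 a).+1 == tagnat.sig2 b :> nat)%:R
  else 0.
Proof.
rewrite mxE; move: (tagnat.sig1 a) (tagnat.sig1 b) (tagnat.sig2 a) (tagnat.sig2 b).
move=> i j u v; case: eqP => [E|]; last by rewrite mxE.
by subst j; rewrite conform_mx_id mxE.
Qed.

(** * Determinants of perturbed Jordan matrices *)

Section JordanBlocks.
Variables (n k : nat) (p : 'I_k -> nat) (l : 'I_k -> C).
Variables (blk : 'I_n -> 'I_k) (pos : 'I_n -> nat) (J : 'M[C]_n).
Hypothesis blk_pos_inj : forall a b, blk a = blk b -> pos a = pos b -> a = b.
Hypothesis pos_lt : forall a, (pos a < p (blk a))%N.
Hypothesis blk_pos_surj : forall i r, (r < p i)%N -> exists a, blk a = i /\ pos a = r.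
Hypothesis p_gt0 : forall i, (0 < p i)%N.
Hypothesis J_E : forall a b, J a b =
  if blk a == blk b then l (blk a) *+ (pos a == pos b) + ((pos a).+1 == pos b)%:R else 0.
Variable lam : C.

Let N := J - lam%:M.

Definition last_row a := (l (blk a) == lam) && ((pos a).+1 == p (blk a)).
Definition first_col b := (l (blk b) == lam) && (pos b == 0%N).
(* With respect to the last rows and the first columns of the blocks with
   eigenvalue lam, this is the all-ones matrix minus the identity: it is
   invertible but has no diagonal block. *)
Definition coupling : 'M[C]_n :=
  \matrix_(a, b) [&& last_row a, first_col b & blk a != blk b]%:R.

Lemma N_E a b : N a b = if blk a == blk b then
  (l (blk a) - lam) *+ (pos a == pos b) + ((pos a).+1 == pos b)%:R else 0.
Proof.
rewrite !mxE J_E; case: eqP => ab; last first.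
  by case: eqP => [E|]; [rewrite E in ab|rewrite subr0].
have -> : (a == b) = (pos a == pos b).
  by apply/eqP/eqP => [->//|]; apply: blk_pos_inj.
by rewrite mulrnBl addrAC.
Qed.

Lemma N_last_row a b : last_row a -> N a b = 0.
Proof.
move=> /andP[/eqP la /eqP pa]; rewrite N_E la subrr mul0rn add0r.
case: eqP => // ab; rewrite pa ab.
by rewrite gtn_eqF // pos_lt.
Qed.

(** A kernel vector [w] is determined block by block. In blocks with another eigenvalue it vanishes
    by descending position; in those with eigenvalue [lam], the rows other than the last kill every
    entry but the first. The last rows then say that each first entry equals the sum [S] of all of
    them, so S = z S with z >= 2 the number of such blocks, and S = 0. *)
Lemma coupling_det_neq0 (i0 j0 : 'I_k) : i0 != j0 -> l i0 = lam -> l j0 = lam ->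
  \det (N + coupling) != 0.
Proof.
move=> ij li lj; rewrite -det_tr; apply/det0P => -[v v0 Ev]; move/negP: v0; apply.
pose w a := v 0 a.
have Ew a : \sum_b N a b * w b + \sum_b coupling a b * w b = 0.
  have := congr1 (fun M : 'rV_n => M 0 a) Ev; rewrite mxE [RHS]mxE => E.
  rewrite -big_split -[RHS]E /=; apply: eq_bigr => b _.
  by rewrite [RHS]mulrC -mulrDl [_^T _ _]mxE [(N + _) a b]mxE.
have sumN a a' : blk a = blk a' -> (pos a).+1 = pos a' ->
    \sum_b N a b * w b = (l (blk a) - lam) * w a + w a'.
  move=> ba pa; have aa' : a' != a by apply/eqP => E; move: pa; rewrite E; lia.
  rewrite (bigD1 a) //= (bigD1 a') //= big1 ?addr0 => [|b /andP[b1 b2]].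
    rewrite !N_E ba !eqxx -pa eqxx mulr1n.
    by rewrite [_ == pos a]gtn_eqF // addr0 ltn_eqF // mulr0n add0r mul1r.
  rewrite N_E; case: eqP => [ab|]; last by rewrite mul0r.
  case: eqP => [/(blk_pos_inj ab) E|_]; first by rewrite E eqxx in b1.
  case: eqP => [E|_]; last by rewrite mulr0n add0r mul0r.
  by move/eqP: b2; case; apply: blk_pos_inj; [rewrite -ab|rewrite -E].
have sumN_last a : (pos a).+1 = p (blk a) -> \sum_b N a b * w b = (l (blk a) - lam) * w a.
  move=> pa; rewrite (bigD1 a) //= big1 ?addr0 => [|b b1].
    by rewrite N_E !eqxx mulr1n gtn_eqF // addr0.
  rewrite N_E; case: eqP => [ab|]; last by rewrite mul0r.
  case: eqP => [/(blk_pos_inj ab) E|_]; first by rewrite E eqxx in b1.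
  by rewrite pa ab gtn_eqF ?pos_lt // mulr0n add0r mul0r.
have sumK0 a : ~~ last_row a -> \sum_b coupling a b * w b = 0.
  by move=> /negPf la; apply: big1 => b _; rewrite mxE la mul0r.
have succ a : (pos a).+1 != p (blk a) -> exists a', blk a = blk a' /\ (pos a).+1 = pos a'.
  move=> pa; have /blk_pos_surj [a' [b1 b2]] : ((pos a).+1 < p (blk a))%N.
    by rewrite ltn_neqAle pa pos_lt.
  by exists a'.
have w_other a : l (blk a) != lam -> w a = 0.
  move=> la; have [m mE] := ubnP (p (blk a) - pos a); elim: m a la mE => // m IH a la am.
  have nl : ~~ last_row a by rewrite /last_row (negPf la).
  have /eqP := Ew a; rewrite (sumK0 _ nl) addr0.
  have [pa|pa] := eqVneq (pos a).+1 (p (blk a)).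
    by rewrite (sumN_last _ pa) mulf_eq0 subr_eq0 (negPf la) => /eqP.
  have [a' [b1 b2]] := succ a pa.
  rewrite (sumN _ _ b1 b2) (IH a') ?addr0 -?b1 //; last by rewrite -b2; have := pos_lt a; lia.
  by rewrite mulf_eq0 subr_eq0 (negPf la) => /eqP.
have w_pos a : l (blk a) = lam -> pos a != 0%N -> w a = 0.
  move=> la pa; have [|a' [b1 b2]] := @blk_pos_surj (blk a) (pos a).-1.
    by have := pos_lt a; lia.
  have nl : ~~ last_row a'.
    by rewrite /last_row b1 b2 la eqxx /=; have := pos_lt a; lia.
  have := Ew a'; rewrite (sumK0 _ nl) addr0 (sumN a' a) ?b1 ?b2 ?la ?subrr ?mul0r ?add0r //.
  by rewrite prednK // lt0n.
pose S := \sum_(b | first_col b) w b.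
have w_first b : first_col b -> w b = S.
  move=> fb; have /andP[/eqP lb /eqP pb] := fb.
  have [|a [b1 b2]] := @blk_pos_surj (blk b) (p (blk b)).-1.
    by have := p_gt0 (blk b); lia.
  have pa : (pos a).+1 = p (blk a) by rewrite b1 b2 prednK.
  have la : last_row a by rewrite /last_row b1 lb eqxx -b1 pa eqxx.
  have := Ew a; rewrite (sumN_last _ pa) b1 lb subrr mul0r add0r => E.
  suff sE : \sum_(c | first_col c && (c != b)) w c = \sum_c coupling a c * w c.
    by rewrite /S (bigD1 b) //= sE E addr0.
  rewrite big_mkcond /=; apply: eq_bigr => c _; rewrite mxE la b1 /=.
  case fc : (first_col c); last by rewrite mul0r.
  have -> : (blk b != blk c) = (c != b).
    congr (~~ _); apply/eqP/eqP => [bc|->//]; apply: blk_pos_inj => //.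
    by rewrite pb; case/andP: fc => _ /eqP.
  by case: (c != b); rewrite ?mul1r ?mul0r.
have S0 : S = 0.
  have [a0 [a1 a2]] := blk_pos_surj (p_gt0 i0).
  have [b0 [b1 b2]] := blk_pos_surj (p_gt0 j0).
  have fa : first_col a0 by rewrite /first_col a1 a2 li !eqxx.
  have fb : first_col b0 && (b0 != a0).
    rewrite /first_col b1 b2 lj !eqxx /=; apply: contra_neq ij => E.
    by rewrite -a1 -b1 E.
  have : S = S * #|[pred b | first_col b]|%:R.
    by rewrite {1}/S (eq_bigr (fun=> S)) ?sumr_const ?mulr_natr.
  rewrite (cardD1 a0) inE fa (cardD1 b0) !inE andbC fb /= !add1n -natr1 mulrDr mulr1.
  rewrite -[X in X = _]add0r => /addIr/esym/eqP; rewrite mulf_eq0 pnatr_eq0 orbF.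
  by move/eqP.
apply/eqP/rowP => a; rewrite mxE -/(w a).
have [la|la] := eqVneq (l (blk a)) lam; last exact: w_other.
have [pa|pa] := eqVneq (pos a) 0%N; last exact: w_pos.
by rewrite w_first // /first_col la pa !eqxx.
Qed.

(** [N + t *: Y] after a factor [t] has been taken out of each last row, where [N] vanishes. For
    arbitrary [Y] it shows that the determinant is divisible by [t] to the number of blocks of
    [lam], with a cofactor continuous in [t]. *)
Definition scaled_rows (Y : 'M[C]_n) t : 'M[C]_n :=
  \matrix_(a, b) if last_row a then Y a b else N a b + t * Y a b.

Lemma det_scaled_rows Y t :
  \det (N + t *: Y) = t ^+ #|[pred a | last_row a]| * \det (scaled_rows Y t).
Proof.
pose D := diag_mx (\row_a if last_row a then t else 1).
have -> : N + t *: Y = D *m scaled_rows Y t.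
  apply/matrixP => a b; rewrite mul_diag_mx !mxE.
  case: ifP => la; last by rewrite mul1r.
  have := N_last_row b la; rewrite !mxE => ->; by rewrite add0r.
rewrite det_mulmx det_diag; congr (_ * _).
rewrite (eq_bigr (fun a => if last_row a then t else 1)); last by move=> a _; rewrite mxE.
by rewrite -big_mkcond /= prodr_const.
Qed.

(** [coupling] is supported on the last rows, so nothing depends on [t] any more: in this direction
    the determinant is exactly a monomial in [t]. *)
Lemma scaled_rows_coupling t : scaled_rows coupling t = N + coupling.
Proof.
apply/matrixP => a b; rewrite [LHS]mxE [RHS]mxE; case: ifP => la.
  by rewrite N_last_row // add0r.
by rewrite [coupling a b]mxE la mulr0.
Qed.

Lemma det_coupling t :
  \det (N + t *: coupling) = t ^+ #|[pred a | last_row a]| * \det (N + coupling).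
Proof. by rewrite det_scaled_rows scaled_rows_coupling. Qed.

Lemma last_row_card_gt0 i0 : l i0 = lam -> (0 < #|[pred a | last_row a]|)%N.
Proof.
move=> li; have [|a [b1 b2]] := @blk_pos_surj i0 (p i0).-1.
  by have := p_gt0 i0; lia.
apply/card_gt0P; exists a; rewrite inE /last_row b1 b2 li eqxx prednK ?eqxx //.
Qed.

End JordanBlocks.

Lemma char_poly_conj n (S X : 'M[C]_n) : S \in unitmx ->
  char_poly (S *m X *m invmx S) = char_poly X.
Proof.
move=> SU; pose S' := map_mx (@polyC C) S; pose T := map_mx (@polyC C) (invmx S).
have ST : S' *m T = 1%:M by rewrite -map_mxM mulmxV // map_mx1.
have -> : char_poly (S *m X *m invmx S) = \det (S' *m char_poly_mx X *m T).
  congr (\det _); rewrite /char_poly_mx mulmxBr mulmxBl !map_mxM -/S' -/T.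
  by rewrite scalar_mxC -['X%:M *m S' *m T]mulmxA ST mulmx1.
by rewrite !det_mulmx mulrAC -det_mulmx ST det1 mul1r.
Qed.

Lemma sigma_conj n (S X : 'M[C]_n) : S \in unitmx -> sigma (S *m X *m invmx S) = sigma X.
Proof. by move=> SU; apply/rowP => j; rewrite !mxE /sigma_coord char_poly_conj. Qed.

Lemma cvg_id_dnbhs0 : (x : C) @[x --> 0^'] --> (0 : C).
Proof. exact: cvg_within. Qed.

Lemma near_dnbhs0_neq0 : \forall x \near (0 : C)^', x != 0.
Proof. exact: withinT. Qed.

Lemma cvg_diff_quotient_line (V W : normedModType C) (g : V -> W) A v :
  differentiable g A ->
  x^-1 *: (g (A + x *: v) - g A) @[x --> (0 : C)^'] --> 'd g A v.
Proof.
move=> dg; apply: (@cvg_diff_quotient _ _ _ g A v _ _ _ id (fun=> v)) => //.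
- exact: cvg_id_dnbhs0.
- exact: cvg_cst.
- exact: near_dnbhs0_neq0.
Qed.

(* Conjugating by S gives sigma (A + x H) = sigma (A + 2 x H), so the differential
   at A takes the same value at H and at 2 H. *)
Lemma ker_dsigma_conj n (S A H : 'M[C]_n) : S \in unitmx ->
  S *m A = A *m S -> S *m H = 2 *: (H *m S) -> ker_dsigma A H.
Proof.
move=> SU SA SH.
have dS := differentiable_sigma A.
have c1 := cvg_diff_quotient_line (v := H) dS.
have c2 := cvg_diff_quotient_line (v := 2 *: H) dS.
have sE (x : C) : sigma (A + x *: (2 *: H)) = sigma (A + x *: H).
  rewrite -[RHS](sigma_conj _ SU); congr sigma.
  rewrite mulmxDr SA -scalemxAr SH mulmxDl mulmxK //; congr (_ + _).
  by rewrite -!scalemxAl mulmxK.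
have E : (fun x : C => x^-1 *: (sigma (A + x *: (2 *: H)) - sigma A)) =
         (fun x => x^-1 *: (sigma (A + x *: H) - sigma A)).
  by apply/funext => x; rewrite sE.
rewrite E in c2.
have : 'd (@sigma C n) A H = 'd (@sigma C n) A (2 *: H) := norm_cvg_unique c1 c2.
rewrite linearZ /ker_dsigma /=; move: ('d _ _ _) => D DD.
have : 2 *: D - D = D by rewrite scaler_nat mulr2n addrK.
by rewrite -DD subrr.
Qed.

Lemma cvg_exprn n (x : C) : y ^+ n @[y --> x] --> x ^+ n.
Proof.
have /derivable1_diffP /differentiable_continuous c : derivable (fun y : C => y ^+ n) x 1.
  exact: exprn_derivable.
exact: c.
Qed.

(** * A direction in the kernel of the differential of sigma and outside C' *)

Section DerogatoryJordan.
Variables (n k : nat) (p : 'I_k -> nat) (l : 'I_k -> C).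
Variables (blk : 'I_n -> 'I_k) (pos : 'I_n -> nat) (J : 'M[C]_n).
Hypothesis blk_pos_inj : forall a b, blk a = blk b -> pos a = pos b -> a = b.
Hypothesis pos_lt : forall a, (pos a < p (blk a))%N.
Hypothesis blk_pos_surj : forall i r, (r < p i)%N -> exists a, blk a = i /\ pos a = r.
Hypothesis p_gt0 : forall i, (0 < p i)%N.
Hypothesis J_E : forall a b, J a b =
  if blk a == blk b then l (blk a) *+ (pos a == pos b) + ((pos a).+1 == pos b)%:R else 0.
Variables (lam : C) (i0 j0 : 'I_k) (A P : 'M[C]_n).
Hypothesis i0j0 : i0 != j0.
Hypothesis li0 : l i0 = lam.
Hypothesis lj0 : l j0 = lam.
Hypothesis PU : P \in unitmx.
Hypothesis PA : P *m A = J *m P.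

Let K := coupling p l blk pos lam.
Let H := invmx P *m K *m P.

(* Double the basis vectors of the block of a: this commutes with J. *)
Lemma ker_dsigma_off_diagonal a b : blk a != blk b ->
  ker_dsigma A (invmx P *m delta_mx a b *m P).
Proof.
move=> ab; pose D : 'M[C]_n := diag_mx (\row_c if blk c == blk a then 2 else 1).
have DU : D \in unitmx.
  rewrite unitmxE unitfE det_diag; apply/prodf_neq0 => c _; rewrite mxE.
  by case: ifP => _; rewrite ?oner_neq0 ?pnatr_eq0.
have AE : A = invmx P *m J *m P by rewrite -mulmxA -PA mulKmx.
have DJ : D *m J = J *m D.
  apply/matrixP => c e; rewrite mul_diag_mx mul_mx_diag !mxE J_E.
  by case: (eqVneq (blk c) (blk e)) => [->|]; rewrite ?mulr0 ?mul0r // mulrC.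
have DE : D *m delta_mx a b = 2 *: (delta_mx a b *m D).
  apply/matrixP => c e; rewrite mul_diag_mx mul_mx_diag !mxE.
  case: (eqVneq c a) => [->|]; last by rewrite /= !mulr0 mul0r mulr0.
  case: (eqVneq e b) => [->|]; last by rewrite /= !mulr0 mul0r mulr0.
  by rewrite !eqxx [blk b == _]eq_sym (negPf ab) !mulr1.
apply: (@ker_dsigma_conj _ (invmx P *m D *m P)).
- by rewrite !unitmx_mul unitmx_inv PU DU.
- by rewrite AE !mulmxA !mulmxK // -!(mulmxA (invmx P)) DJ.
- by rewrite !mulmxA !mulmxK // -(mulmxA (invmx P)) DE -scalemxAr -!scalemxAl !mulmxA.
Qed.

Lemma ker_dsigma_coupling : ker_dsigma A H.
Proof.
rewrite /ker_dsigma /= /H (matrix_sum_delta K) mulmx_sumr mulmx_suml linear_sum.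
apply: big1 => a _; rewrite mulmx_sumr mulmx_suml linear_sum; apply: big1 => b _.
rewrite -scalemxAr -scalemxAl linearZ /= mxE.
case: and3P => [[_ _ ab]|_]; last by rewrite scale0r.
by rewrite (ker_dsigma_off_diagonal ab) scaler0.
Qed.

Let z := #|[pred a | last_row p l blk pos lam a]|.
Let A_sub : A - lam%:M = invmx P *m (J - lam%:M) *m P.
Proof.
rewrite mulmxBr mulmxBl -[invmx P *m J *m P]mulmxA -PA mulKmx //.
by rewrite scalar_mxC -[lam%:M *m _ *m P]mulmxA mulVmx // mulmx1.
Qed.

Let det_sub_line x : \det (A + x *: H - lam%:M) = x ^+ z * \det (J - lam%:M + K).
Proof.
have -> : A + x *: H - lam%:M = invmx P *m (J - lam%:M + x *: K) *m P.
  by rewrite addrAC A_sub [invmx P *m (_ + x *: K)]mulmxDr mulmxDl /H -scalemxAr -scalemxAl.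
rewrite !det_mulmx det_inv mulrAC mulVf ?mul1r -?unitfE -?unitmxE //.
exact: det_coupling.
Qed.

Lemma eigenvalue_jordan : eigenvalue A lam.
Proof.
have /eqP/det0P[v v0] : \det (A - lam%:M) = 0.
  have := det_sub_line 0; rewrite scale0r addr0 expr0n gtn_eqF ?mul0r //.
  exact: (last_row_card_gt0 blk_pos_surj p_gt0 li0).
rewrite mulmxBr mul_mx_scalar => /eqP; rewrite subr_eq0 => /eqP vA.
by apply/eigenvalueP; exists v.
Qed.

Hypothesis lam1 : `|lam| < 1.
Hypothesis A1 : forall a, eigenvalue A a -> `|a| < 1.

Let B0 := Phi lam A.
Let M (X : 'M[C]_n) := 1%:M - lam^* *: X.

Let MU : M A \in unitmx.
Proof. by apply: unitmx_sub_scale; rewrite ?norm_conjC. Qed.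

(** Multiplying by [M A] clears the inverse in [Phi] and leaves [A - lam%:M + t *: (w *m M A)],
    which is conjugate to a perturbation of [J - lam%:M]. Hence the determinant vanishes at [B0] to
    order at least [z] along every line. *)
Let det_Phi_line w : exists Y : 'M[C]_n,
  forall t, \det (B0 + t *: w) * \det (M A) =
     t ^+ z * \det (scaled_rows p l blk pos J lam Y t).
Proof.
exists (P *m (w *m M A) *m invmx P) => t.
rewrite -(det_scaled_rows blk_pos_inj pos_lt J_E) -det_mulmx.
have -> : (B0 + t *: w) *m M A = invmx P *m (J - lam%:M + t *: (P *m (w *m M A) *m invmx P)) *m P.
  rewrite mulmxDl /B0 /Phi mulmxKV // A_sub [invmx P *m (_ + t *: _)]mulmxDr.
  rewrite [RHS]mulmxDl; congr (_ + _).
  by rewrite -scalemxAr -!scalemxAl !mulmxA mulVmx // mul1mx mulmxKV.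
by rewrite !det_mulmx det_inv mulrAC mulVf ?mul1r -?unitfE -?unitmxE.
Qed.

Lemma coupling_notin_Cstar : ~ Cstar B0 ('d (@Phi C n lam) A H).
Proof.
move=> HC.
have [a00 [b00 _]] := blk_pos_surj (p_gt0 i0).
have n0 : (0 < n)%N by apply: leq_ltn_trans (ltn_ord a00).
have jlt : (n.-1 < n)%N by rewrite prednK.
(* Indices start at 0, so the coordinate [n.-1] is sigma_n, the determinant. *)
pose j := Ordinal jlt.
have sE (X : 'M[C]_n) : sigma_coord j X = \det X.
  rewrite /sigma_coord /= prednK // subnn char_poly_det mulrA -exprD addnn.
  by rewrite -mul2n exprM sqrrN expr1n expr1n mul1r.
have z0 : (0 < z)%N by apply: (last_row_card_gt0 blk_pos_surj p_gt0 li0).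
have dB0 : \det B0 = 0.
  have [Y /(_ 0)] := det_Phi_line 0; rewrite scale0r addr0 expr0n gtn_eqF // mul0r => /eqP.
  by rewrite mulf_eq0 -[\det (M A) == 0]negbK -unitfE -unitmxE MU orbF => /eqP.
have [P0 P0l] : exists P, is_lowest_form (sigma_coord j : 'M[C]_n -> C) B0 P.
  have -> : (sigma_coord j : 'M[C]_n -> C) = mxeval (sigma_poly j).
    by apply/funext => X; exact: sigma_polyE.
  apply: (@exists_lowest_form _ _ _ _ 1%:M).
  by rewrite -!sigma_polyE !sE dB0 det1 oner_neq0.
have := HC j; rewrite /lowest_form.
have /= := @xgetPex _ 0 [set P | is_lowest_form (sigma_coord j : 'M[C]_n -> C) B0 P]
  (ex_intro _ P0 P0l).
set Q := xget _ _ => -[d [d0 Qd Q0 Qo]] QH.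
have MA0 : \det (M A) != 0 by rewrite -unitfE -unitmxE.
(* If [d] were less than [z], the quotient of order [d] would tend to 0 along every line by
   [det_Phi_line], whereas its limit is [mxeval Q w], nonzero for some [w]. *)
have zd : (z <= d)%N.
  rewrite leqNgt; apply/negP => dz.
  have [w] := mxeval_neq0 Q0; apply/negP; rewrite negbK; apply/eqP.
  have [Y HY] := det_Phi_line w.
  have c1 : (x ^+ d)^-1 * (sigma_coord j (B0 + x *: w) - sigma_coord j B0) @[x --> (0 : C)^']
      --> mxeval Q w.
    apply: (@cvg_lowest_quotient _ _ _ _ w _ d _ _ _ id (fun=> w)) => //.
    - exact: cvg_id_dnbhs0.
    - exact: cvg_cst.
    - exact: near_dnbhs0_neq0.
  apply: (norm_cvg_unique c1).
  pose q x := \det (scaled_rows p l blk pos J lam Y x).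
  have E : \forall x \near (0 : C)^', x ^+ (z - d) * (q x / \det (M A)) =
      (x ^+ d)^-1 * (sigma_coord j (B0 + x *: w) - sigma_coord j B0).
    apply: filterS near_dnbhs0_neq0 => x x0.
    rewrite !sE dB0 subr0 -[\det (B0 + _)](mulfK MA0) HY -/(q x).
    by rewrite -{2}(subnK (ltnW dz)) exprD; field; rewrite expf_neq0 ?MA0.
  have dr : differentiable (fun x : C => scaled_rows p l blk pos J lam Y x) 0.
    apply: differentiable_mx_entries => a b; under eq_fun do rewrite mxE.
    case: last_row; first exact: differentiable_cst.
    apply: differentiableD; first exact: differentiable_cst.
    apply: (@differentiableM _ _ id (fun=> Y a b)); [exact: ex_diff|exact: differentiable_cst].
  have /differentiable_continuous cq := differentiable_comp dr (differentiable_det _).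
  have c2 : q x / \det (M A) @[x --> (0 : C)^'] --> q 0 / \det (M A).
    by apply: cvgM; [exact: (cvg_comp _ _ cvg_id_dnbhs0 cq)|exact: cvg_cst].
  have c3 : (x : C) ^+ (z - d) @[x --> 0^'] --> (0 : C) ^+ (z - d).
    exact: (cvg_comp _ _ cvg_id_dnbhs0 (@cvg_exprn (z - d) 0)).
  have c4 := cvgM c3 c2.
  rewrite expr0n subn_eq0 leqNgt dz /= mul0r in c4.
  by apply: (cvg_trans (near_eq_cvg E)); exact: c4.
have dPhi := differentiable_Phi MU.
(* With this exact difference quotient as direction, [B0 + x *: u x] is [Phi lam (A + x *: H)] for
   nonzero [x], with no error term. *)
pose u (x : C) := x^-1 *: (Phi lam (A + x *: H) - B0).
have c1 : (x ^+ d)^-1 * (sigma_coord j (B0 + x *: u x) - sigma_coord j B0) @[x --> (0 : C)^']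
    --> (0 : C).
  rewrite -[X in _ --> X]QH.
  apply: (@cvg_lowest_quotient _ _ _ _ _ _ d _ _ _ id u) => //.
  - exact: cvg_id_dnbhs0.
  - exact: cvg_diff_quotient_line.
  - exact: near_dnbhs0_neq0.
have /eqP := coupling_det_neq0 blk_pos_inj pos_lt blk_pos_surj p_gt0 J_E i0j0 li0 lj0; apply.
rewrite -/K; set c := \det _.
have cM : (\det (M (A + x *: H)) : C) @[x --> (0 : C)^'] --> (\det (M A) : C).
  have dM : differentiable (fun x : C => M (A + x *: H)) 0.
    apply: differentiable_mx_entries => a b; under eq_fun do rewrite !mxE.
    apply: differentiableB; first exact: differentiable_cst.
    apply: (@differentiableM _ _ (fun=> _)); first exact: differentiable_cst.
    apply: differentiableD; first exact: differentiable_cst.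
    apply: (@differentiableM _ _ id (fun=> _)); [exact: ex_diff|exact: differentiable_cst].
  have /differentiable_continuous cq := differentiable_comp dM (differentiable_det _).
  have := cvg_comp _ _ cvg_id_dnbhs0 cq.
  by rewrite /= scale0r addr0.
have c0 : (x : C) ^+ (d - z) @[x --> 0^'] --> (0 : C) ^+ (d - z).
  exact: (cvg_comp _ _ cvg_id_dnbhs0 (@cvg_exprn (d - z) 0)).
(* By [det_sub_line] this product is constantly [c] near 0, but it tends to 0 because [Q] vanishes
   at the limit of [u]. The factor [x ^+ (d - z)] treats d = z and d > z at once. *)
have c2 := cvgM (cvgM c0 cM) c1; rewrite mulr0 in c2.
have cc : c @[x --> (0 : C)^'] --> c by exact: cvg_cst.
have MUn : \forall x \near (0 : C)^', \det (M (A + x *: H)) != 0.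
  have e0 : 0 < `|\det (M A)| by rewrite normr_gt0.
  have /cvgrPdist_lt /(_ _ e0) := cM.
  by apply: filterS => x; apply: contraTneq => ->; rewrite subr0 ltxx.
have E : \forall x \near (0 : C)^', x ^+ (d - z) * \det (M (A + x *: H)) *
    ((x ^+ d)^-1 * (sigma_coord j (B0 + x *: u x) - sigma_coord j B0)) = c.
  apply: filterS2 MUn near_dnbhs0_neq0 => x Mx x0.
  have -> : B0 + x *: u x = Phi lam (A + x *: H).
    by rewrite /u scalerA mulfV // scale1r addrC subrK.
  rewrite !sE dB0 subr0 /Phi det_mulmx det_inv det_sub_line -/(M _) -/c.
  by rewrite -{2}(subnK zd) exprD; field; rewrite Mx !expf_neq0.
have c3 : c @[x --> (0 : C)^'] --> (0 : C).
  by apply: (cvg_trans (near_eq_cvg E)); exact: c2.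
exact: (norm_cvg_unique cc c3).
Qed.

End DerogatoryJordan.

End Derogatory.

(** * Holomorphic functions on the disc *)

Local Open Scope complex_scope.
Local Open Scope classical_set_scope.

Section ComplexAnalysis.
Context {R : realType}.
Local Notation C := R[i].
Local Notation CC := (R[i] : numClosedFieldType).
Local Notation N := (@ComplexField.Normc.normc R).
Implicit Types (f g F : C -> C) (h z w a p q l c : C).

Lemma normc_ge0 z : 0 <= N z.
Proof. by case: z => x y; rewrite /= sqrtr_ge0. Qed.

Lemma normcDle z w : N (z + w) <= N z + N w.
Proof. exact: le_normcD. Qed.

Lemma normcBle z w : N (z - w) <= N z + N w.
Proof. by rewrite -[N w]normcN normcDle. Qed.

Lemma normc_real (x : R) : N x%:C = `|x|.
Proof. by rewrite /= expr0n /= addr0 sqrtr_sqr. Qed.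

Lemma normcX z n : N (z ^+ n) = N z ^+ n.
Proof.
elim: n => [|n IH]; first by rewrite !expr0 ComplexField.Normc.normc1.
by rewrite !exprS ComplexField.Normc.normcM IH.
Qed.

Lemma normc_Re z : `|complex.Re z| <= N z.
Proof.
case: z => x y /=; rewrite -sqrtr_sqr ler_sqrt ?addr_ge0 ?sqr_ge0 //.
by rewrite lerDl sqr_ge0.
Qed.

Lemma normc_Im z : `|complex.Im z| <= N z.
Proof.
case: z => x y /=; rewrite -sqrtr_sqr ler_sqrt ?addr_ge0 ?sqr_ge0 //.
by rewrite lerDr sqr_ge0.
Qed.

Lemma normc_le (x y : R) : N (x +i* y) <= `|x| + `|y|.
Proof.
rewrite /= -[leRHS]ger0_norm ?addr_ge0 // -[leRHS]sqrtr_sqr ler_sqrt ?sqr_ge0//.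
rewrite -(real_normK (num_real x)) -(real_normK (num_real y)).
by rewrite sqrrD lerD2r lerDl mulrn_wge0 // mulr_ge0.
Qed.

Lemma normc_eq0 z : (N z == 0) = (z == 0).
Proof.
by apply/eqP/eqP => [/ComplexField.Normc.eq0_normc//|->]; rewrite ComplexField.Normc.normc0.
Qed.

Lemma normc_gt0 z : (0 < N z) = (z != 0).
Proof. by rewrite lt0r normc_eq0 normc_ge0 andbT. Qed.

(** * Bisection and Goursat's lemma for Riemann sums *)

Lemma exists_half_pow_lt (x e : R) : 0 < e ->
  exists K, forall k, (K <= k)%N -> x / 2 ^+ k < e.
Proof.
move=> e0; exists (Num.bound (`|x| / e)) => k Kk.
have xk : `|x| / e < 2 ^+ k.
  have /archi_boundP H : 0 <= `|x| / e by rewrite divr_ge0 // ltW.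
  apply: lt_le_trans H _; rewrite -natrX ler_nat.
  exact: leq_trans Kk (ltnW (ltn_expl _ _)).
rewrite ltr_pdivrMr ?exprn_gt0 // (le_lt_trans (ler_norm x)) //.
by rewrite mulrC -ltr_pdivrMr.
Qed.

(** Otherwise failing quarters would nest down to a point (u, v), around which all small rectangles
    are good. [Q k x y] speaks of the rectangle with corner (x, y) and sides p / 2^k and q / 2^k;
    either side may be 0, so that segments are covered too. *)
Lemma bisection (Q : nat -> R -> R -> Prop) (x0 y0 p q : R) :
  0 <= p -> 0 <= q ->
  (forall k x y (p' := p / 2 ^+ k.+1) (q' := q / 2 ^+ k.+1),
     Q k.+1 x y -> Q k.+1 (x + p') y -> Q k.+1 x (y + q') ->
     Q k.+1 (x + p') (y + q') -> Q k x y) ->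
  (forall u v, x0 <= u <= x0 + p -> y0 <= v <= y0 + q ->
     exists K, forall k x y, (K <= k)%N ->
       x <= u <= x + p / 2 ^+ k -> y <= v <= y + q / 2 ^+ k -> Q k x y) ->
  Q 0%N x0 y0.
Proof.
move=> p0 q0 step loc; apply: contrapT => nQ.
pose good k (s t : R * R) := ~ Q k s.1 s.2 ->
  [/\ ~ Q k.+1 t.1 t.2,
      t.1 = s.1 \/ t.1 = s.1 + p / 2 ^+ k.+1 &
      t.2 = s.2 \/ t.2 = s.2 + q / 2 ^+ k.+1].
have exg k s : exists t, good k s t.
  have [Qs|Qs] := pselect (Q k s.1 s.2); first by exists s => /(_ Qs).
  apply: contrapT => nex; apply: Qs; apply: step; apply: contrapT => nQ'; apply: nex.
  - by exists s; split => //; left.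
  - by exists (s.1 + p / 2 ^+ k.+1, s.2); split => //=; [right|left].
  - by exists (s.1, s.2 + q / 2 ^+ k.+1); split => //=; [left|right].
  - by exists (s.1 + p / 2 ^+ k.+1, s.2 + q / 2 ^+ k.+1); split => //=; right.
pose nxt k s := sval (cid (exg k s)).
pose fix st k := if k is k'.+1 then nxt k' (st k') else (x0, y0).
have nQst k : ~ Q k (st k).1 (st k).2.
  elim: k => [//|k IH] /=; rewrite /nxt; case: cid => t /= gt.
  by have [] := gt IH.
have stS k : [/\ (st k.+1).1 = (st k).1 \/ (st k.+1).1 = (st k).1 + p / 2 ^+ k.+1 &
      (st k.+1).2 = (st k).2 \/ (st k.+1).2 = (st k).2 + q / 2 ^+ k.+1].
  by rewrite /= /nxt; case: cid => t /= gt; have [] := gt (nQst k).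
have nested (u : nat -> R) (d : R) : 0 <= d ->
    (forall k, u k.+1 = u k \/ u k.+1 = u k + d / 2 ^+ k.+1) ->
    exists l : R, forall k, u k <= l <= u k + d / 2 ^+ k.
  move=> d0 uS.
  have dS k : d / 2 ^+ k = d / 2 ^+ k.+1 + d / 2 ^+ k.+1.
    by rewrite exprS; field; rewrite expf_neq0.
  have dk k : 0 <= d / 2 ^+ k by rewrite divr_ge0 // exprn_ge0.
  have mono k j : u k <= u (k + j)%N /\ u (k + j)%N + d / 2 ^+ (k + j) <= u k + d / 2 ^+ k.
    elim: j => [|j [IH1 IH2]]; first by rewrite addn0.
    rewrite addnS; have := dS (k + j)%N; have := dk (k + j).+1.
    by case: (uS (k + j)%N) => ->; lra.
  have le k j : u k <= u j + d / 2 ^+ j.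
    have [kj|/ltnW jk] := leqP k j.
      by have := mono k (j - k)%N; rewrite subnKC // => -[]; have := dk j; lra.
    by have := mono j (k - j)%N; rewrite subnKC // => -[]; have := dk k; lra.
  have hs : has_sup (range u).
    split; first by exists (u 0%N), 0%N.
    by exists (u 0%N + d / 2 ^+ 0) => _ [k _ <-]; apply: le.
  exists (sup (range u)) => k; apply/andP; split.
    by apply: sup_ubound; [case: hs|exists k].
  by apply: ge_sup; [case: hs|move=> _ [j _ <-]; apply: le].
have [u Hu] := nested (fun k => (st k).1) p p0 (fun k => (stS k).1).
have [v Hv] := nested (fun k => (st k).2) q q0 (fun k => (stS k).2).
have [K HK] : exists K, forall k x y, (K <= k)%N ->
    x <= u <= x + p / 2 ^+ k -> y <= v <= y + q / 2 ^+ k -> Q k x y.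
  by apply: loc; [have := Hu 0%N|have := Hv 0%N]; rewrite /= expr0 divr1.
by apply: (nQst K); apply: HK.
Qed.

(* Complex differentiability with moduli in R instead of R[i], where lra applies. *)
Definition has_cderiv f z l := forall e : R, 0 < e -> exists2 d : R, 0 < d &
  forall h : C, N h < d -> N (f (z + h) - f z - h * l) <= e * N h.

(* The left Riemann sum of order 2 ^ n of F along the segment from a to a + p,
   divided by p. *)
Definition segment_mean n F a p : C :=
  (2 ^+ n)^-1 * \sum_(0 <= j < 2 ^ n) F (a + j%:R / 2 ^+ n * p).

(** A discrete contour integral along the boundary of a parallelogram, traversed as a, a + p, a + p
    + q, a + q. *)
Definition parallelogram_sum n F a p q : C :=
  p * (segment_mean n F a p - segment_mean n F (a + q) p) +
  q * (segment_mean n F (a + p) q - segment_mean n F a q).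

Lemma segment_meanS n F a p :
  segment_mean n.+1 F a p =
  (segment_mean n F a (p / 2) + segment_mean n F (a + p / 2) (p / 2)) / 2.
Proof.
have n2 : (2 ^+ n : C) != 0 by rewrite expf_neq0.
rewrite /segment_mean.
rewrite (@big_cat_nat _ _ _ (2 ^ n)) //=; last by rewrite leq_exp2l.
have -> : \sum_(2 ^ n <= j < 2 ^ n.+1) F (a + j%:R / 2 ^+ n.+1 * p) =
    \sum_(0 <= j < 2 ^ n) F (a + p / 2 + j%:R / 2 ^+ n * (p / 2)).
  rewrite expnS mul2n -addnn -{1}[(2 ^ n)%N]add0n big_addn addnK.
  apply: eq_bigr => j _; congr F; rewrite natrD natrX exprS.
  by field; rewrite n2.
have -> : \sum_(0 <= j < 2 ^ n) F (a + j%:R / 2 ^+ n.+1 * p) =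
    \sum_(0 <= j < 2 ^ n) F (a + j%:R / 2 ^+ n * (p / 2)).
  by apply: eq_bigr => j _; congr F; rewrite exprS; field; rewrite n2.
by rewrite exprS; field; rewrite n2.
Qed.

(* The inner sides of the subdivision cancel exactly: no integral is needed. *)
Lemma parallelogram_sumS n F a p q :
  parallelogram_sum n.+1 F a p q =
  parallelogram_sum n F a (p / 2) (q / 2) +
  parallelogram_sum n F (a + p / 2) (p / 2) (q / 2) +
  parallelogram_sum n F (a + q / 2) (p / 2) (q / 2) +
  parallelogram_sum n F (a + p / 2 + q / 2) (p / 2) (q / 2).
Proof.
rewrite /parallelogram_sum !segment_meanS.
have -> : a + p / 2 + q / 2 + q / 2 = a + q + p / 2 by field.
have -> : a + p / 2 + q / 2 + p / 2 = a + p + q / 2 by field.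
have -> : a + p / 2 + p / 2 = a + p by field.
have -> : a + q / 2 + q / 2 = a + q by field.
have -> : a + q / 2 + p / 2 = a + p / 2 + q / 2 by field.
by field.
Qed.

Lemma normc_sum (I : Type) (r : seq I) (P : pred I) (E : I -> C) :
  N (\sum_(i <- r | P i) E i) <= \sum_(i <- r | P i) N (E i).
Proof.
elim/big_ind2: _ => [|x a y b xa yb|//]; first by rewrite ComplexField.Normc.normc0.
exact: le_trans (normcDle _ _) (lerD xa yb).
Qed.

Lemma normc_segment_mean n F a p (e : R) :
  (forall t : R, 0 <= t <= 1 -> N (F (a + t%:C * p)) <= e) -> N (segment_mean n F a p) <= e.
Proof.
move=> Fe; rewrite /segment_mean ComplexField.Normc.normcM.
rewrite ComplexField.Normc.normcV normcX.
have -> : N 2 = 2 :> R.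
  have -> : (2 : C) = (2 : R)%:C by rewrite rmorph_nat.
  by rewrite normc_real ger0_norm.
rewrite ler_pdivrMl ?exprn_gt0 //; apply: le_trans (normc_sum _ _ _) _.
have -> : 2 ^+ n * e = \sum_(0 <= j < 2 ^ n) e.
  by rewrite sumr_const_nat subn0 -natrX mulr_natl.
rewrite big_nat [leRHS]big_nat; apply: ler_sum => j /andP [_ jn].
have -> : (j%:R / 2 ^+ n : C) = (j%:R / 2 ^+ n)%:C.
  by rewrite fmorph_div rmorphXn !rmorph_nat.
apply: Fe; rewrite divr_ge0 ?exprn_ge0 //= ler_pdivrMr ?exprn_gt0 // mul1r.
by rewrite -natrX ler_nat ltnW.
Qed.

Lemma segment_meanD n F G a p :
  segment_mean n (F \+ G) a p = segment_mean n F a p + segment_mean n G a p.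
Proof. by rewrite /segment_mean -mulrDr big_split. Qed.

Lemma segment_mean_cst n c a p : segment_mean n (fun=> c) a p = c.
Proof.
by rewrite /segment_mean sumr_const_nat subn0 -[c *+ _]mulr_natl natrX mulKf.
Qed.

Lemma segment_meanZ n F c a p :
  segment_mean n (fun z => c * F z) a p = c * segment_mean n F a p.
Proof. by rewrite /segment_mean -mulr_sumr mulrCA. Qed.

Lemma eq_segment_mean n F G a p :
  (forall t : R, F (a + t%:C * p) = G (a + t%:C * p)) ->
  segment_mean n F a p = segment_mean n G a p.
Proof.
move=> FG; rewrite /segment_mean; congr (_ * _); apply: eq_bigr => j _.
have -> : (j%:R / 2 ^+ n : C) = (j%:R / 2 ^+ n)%:C.
  by rewrite fmorph_div rmorphXn !rmorph_nat.
exact: FG.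
Qed.

Lemma segment_mean_shift n F a b p :
  segment_mean n F (a + b) p = segment_mean n (fun w => F (w + b)) a p.
Proof.
by rewrite /segment_mean; congr (_ * _); apply: eq_bigr => j _; rewrite addrAC.
Qed.

Lemma parallelogram_sumD n F G a p q :
  parallelogram_sum n (F \+ G) a p q =
  parallelogram_sum n F a p q + parallelogram_sum n G a p q.
Proof. by rewrite /parallelogram_sum !segment_meanD; ring. Qed.

(** Opposite sides are sampled at translated nodes, so the two differences of means are exactly - q
    l and p l; they cancel at every order [n], not only in the limit. *)
Lemma parallelogram_sum_affine n c l a p q :
  parallelogram_sum n (fun z => c + z * l) a p q = 0.
Proof.
have shift b v : segment_mean n (fun z => c + z * l) (a + b) v =
    segment_mean n (fun z => c + z * l) a v + b * l.
  rewrite segment_mean_shift -[b * l](segment_mean_cst n _ a v) -segment_meanD.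
  by apply: eq_segment_mean => t /=; rewrite mulrDl addrA.
by rewrite /parallelogram_sum !shift; ring.
Qed.

Lemma normc_parallelogram_sum n F a p q (e : R) :
  (forall s t : R, 0 <= s <= 1 -> 0 <= t <= 1 -> N (F (a + s%:C * p + t%:C * q)) <= e) ->
  N (parallelogram_sum n F a p q) <= 2 * e * (N p + N q).
Proof.
move=> Fe.
have I0 : 0 <= (0 : R) <= 1 by rewrite lexx ler01.
have I1 : 0 <= (1 : R) <= 1 by rewrite ler01 lexx.
apply: le_trans (normcDle _ _) _; rewrite [leRHS]mulrDr.
apply: lerD; rewrite ComplexField.Normc.normcM [leRHS]mulrC ler_wpM2l ?normc_ge0 //.
  apply: le_trans (normcBle _ _) _; apply: le_trans (_ : e + e <= _); last by lra.
  apply: lerD; apply: normc_segment_mean => t tI.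
    by have := Fe t 0 tI I0; rewrite mul0r addr0.
  by have := Fe t 1 tI I1; rewrite mul1r addrAC.
apply: le_trans (normcBle _ _) _; apply: le_trans (_ : e + e <= _); last by lra.
  apply: lerD; apply: normc_segment_mean => t tI.
  by have := Fe 1 t I1 tI; rewrite mul1r.
by have := Fe 0 t I0 tI; rewrite mul0r addr0.
Qed.

Lemma normc_imag (x : R) : N (0 +i* x) = `|x|.
Proof. by rewrite /= expr0n /= add0r sqrtr_sqr. Qed.

(* Goursat's bisection: near a point where F is differentiable, the sum of its
   affine part vanishes and the rest is small compared with the area. *)
Lemma goursat F (x0 y0 p q e : R) : 0 <= p -> 0 <= q -> 0 < e ->
  (forall u v, x0 <= u <= x0 + p -> y0 <= v <= y0 + q ->
     exists l, has_cderiv F (u +i* v) l) ->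
  exists n0, forall n, (n0 <= n)%N ->
    N (parallelogram_sum n F (x0 +i* y0) p%:C (0 +i* q)) <= e.
Proof.
move=> p0 q0 e0 dF.
(* The bound shrinks like the area, hence [4 ^+ k]; the threshold [n0] may depend on the
   rectangle. *)
pose Q k x y := exists n0, forall n, (n0 <= n)%N ->
  N (parallelogram_sum n F (x +i* y) (p / 2 ^+ k)%:C (0 +i* (q / 2 ^+ k)))
    <= e / 4 ^+ k.
suff : Q 0%N x0 y0 by rewrite /Q !expr0 !divr1.
apply: (@bisection Q x0 y0 p q p0 q0) => [k x y p' q' [n1 H1] [n2 H2] [n3 H3] [n4 H4]|u v xu yv].
  (* The successor is the order consumed by one subdivision. *)
  exists (maxn (maxn n1 n2) (maxn n3 n4)).+1 => -[//|n]; rewrite ltnS !geq_max.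
  move=> /andP [/andP[/H1{}H1 /H2{}H2] /andP[/H3{}H3 /H4{}H4]].
  rewrite parallelogram_sumS.
  have hC (d : R) : (d / 2 ^+ k)%:C / 2 = (d / 2 ^+ k.+1)%:C.
    by rewrite !fmorph_div !rmorphXn !rmorph_nat exprS; field; rewrite expf_neq0.
  have hI (d : R) : (0 +i* d : C) = 'i * d%:C by simpc.
  have -> : (0 +i* (q / 2 ^+ k)) / 2 = 0 +i* (q / 2 ^+ k.+1).
    by rewrite hI -mulrA hC -hI.
  rewrite hC.
  have addx (a b d : R) : (a +i* b) + d%:C = (a + d) +i* b by simpc.
  have addy (a b d : R) : (a +i* b) + (0 +i* d) = a +i* (b + d) by simpc.
  rewrite !(addx, addy) -/p' -/q'.
  have e4 : e / 4 ^+ k = 4 * (e / 4 ^+ k.+1).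
    by rewrite exprS; field; rewrite expf_neq0.
  rewrite e4.
  apply: le_trans (le_trans (normcDle _ _) (lerD (le_trans (normcDle _ _)
    (lerD (normcDle _ _) (lexx _))) (lexx _))) _.
  have -> : 4 * (e / 4 ^+ k.+1) =
      e / 4 ^+ k.+1 + e / 4 ^+ k.+1 + e / 4 ^+ k.+1 + e / 4 ^+ k.+1 by ring.
  by rewrite !lerD.
have [l Hl] := dF u v xu yv.
(* Chosen so that 2 e' (p + q)^2 <= e; the [+ 1] keeps the denominator positive when p = q = 0. *)
pose e' := e / (2 * (p + q) ^+ 2 + 1).
have D0 : 0 < 2 * (p + q) ^+ 2 + 1 by rewrite ltr_wpDl // mulr_ge0 // sqr_ge0.
have e'0 : 0 < e' by rewrite divr_gt0.
have [d d0 Hd] := Hl e' e'0.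
have [K HK] := exists_half_pow_lt (p + q) d0.
exists K => k x y Kk /andP[xu1 xu2] /andP[yv1 yv2]; exists 0%N => n _.
set w0 := u +i* v in Hd.
pose E z := F z - F w0 - (z - w0) * l.
have -> : F = (fun z => (F w0 - w0 * l) + z * l) \+ E.
  by apply/funext => z /=; rewrite /E; ring.
rewrite parallelogram_sumD parallelogram_sum_affine add0r.
have pk0 : 0 <= p / 2 ^+ k by rewrite divr_ge0 // exprn_ge0.
have qk0 : 0 <= q / 2 ^+ k by rewrite divr_ge0 // exprn_ge0.
have pqk : p / 2 ^+ k + q / 2 ^+ k = (p + q) / 2 ^+ k by rewrite mulrDl.
have pqkd := HK k Kk.
apply: (le_trans (normc_parallelogram_sum _ (e := e' * ((p + q) / 2 ^+ k)) _)); last first.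
  rewrite normc_real normc_imag !ger0_norm // pqk.
  have -> : 2 * (e' * ((p + q) / 2 ^+ k)) * ((p + q) / 2 ^+ k) =
     e' * (2 * (p + q) ^+ 2) / 4 ^+ k.
    have -> : (4 : R) = 2 * 2 by ring.
    by rewrite exprMn; field; rewrite expf_neq0.
  apply: ler_wpM2r; first by rewrite invr_ge0 exprn_ge0.
  rewrite /e' mulrAC ler_pdivrMr //.
  by apply: ler_wpM2l; [exact: ltW|rewrite lerDl].
move=> s t /andP[s0 s1] /andP[t0 t1].
have -> : (x +i* y) + s%:C * (p / 2 ^+ k)%:C + t%:C * (0 +i* (q / 2 ^+ k)) =
   w0 + ((x + s * (p / 2 ^+ k) - u) +i* (y + t * (q / 2 ^+ k) - v)).
  by rewrite /w0; simpc; congr (_ +i* _); ring.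
set h := (X in w0 + X).
have Nh : N h <= (p + q) / 2 ^+ k.
  apply: le_trans (normc_le _ _) _; rewrite -pqk; apply: lerD; rewrite ler_norml; nra.
have := Hd h (le_lt_trans Nh pqkd); rewrite /E.
have -> : w0 + h - w0 = h by ring.
by move=> /le_trans; apply; rewrite ler_wpM2l // ltW.
Qed.

(** * Complex differentiability and its calculus rules *)

Lemma near0C (P : CC -> Prop) : (\forall h \near (0 : CC), P h) <->
  exists2 d : R, 0 < d & forall h : C, N h < d -> P h.
Proof.
split=> [/nbhs_ballP [e /= e0 He]|[d d0 Hd]].
  have eE : e = (complex.Re e)%:C by rewrite RRe_real // gtr0_real.
  exists (complex.Re e); first by rewrite -ltcR -eE.
  by move=> h hd; apply: He; rewrite /ball /= sub0r normrN eE ltcR.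
apply/nbhs_ballP; exists (d%:C : CC); first by rewrite /= ltcR.
by move=> h; rewrite /ball /= sub0r normrN ltcR => /Hd.
Qed.

Lemma has_cderivP f z l : has_cderiv f z l <->
  is_derive (z : CC) 1 (f : CC -> CC) l.
Proof.
have key : has_cderiv f z l <->
    (fun h : CC => h^-1 *: ((f \o shift z) (h *: 1) - f z) : CC) @ 0^' --> (l : CC).
  rewrite cvgrPdist_le; split=> [Hf e e0|Hf e e0].
    have eE : e = (complex.Re e)%:C by rewrite RRe_real // gtr0_real.
    have [|d d0 Hd] := Hf (complex.Re e); first by rewrite -ltcR -eE.
    apply/near0C; exists d => // h hd h0; rewrite eE lecR.
    have /= := Hd h hd; rewrite [_ *: 1]mulr1 (addrC h) => Hh.
    rewrite -(@ler_pM2r _ (N h)) ?normc_gt0 // -ComplexField.Normc.normcM.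
    rewrite -[leLHS]normcN; congr (_ <= _) : Hh; congr N.
    by rewrite /GRing.scale /=; field.
  have /near0C [d d0 Hd] := Hf (e%:C : CC) ltac:(by rewrite ltcR).
  exists d => // h hd; have [->|h0] := eqVneq h 0.
    by rewrite addr0 subrr mul0r subr0 ComplexField.Normc.normc0 mulr0.
  have := Hd h hd h0; rewrite lecR /= [_ *: 1]mulr1 (addrC h).
  rewrite -(@ler_pM2r _ (N h)) ?normc_gt0 // -ComplexField.Normc.normcM.
  rewrite -[leLHS]normcN => Hh; congr (_ <= _) : Hh; congr N.
  by rewrite /GRing.scale /=; field.
split=> [/key H|[H1 H2]].
  by apply: DeriveDef; [apply/cvg_ex; exists l|apply/cvg_lim].
by apply/key; rewrite -H2; exact: H1.
Qed.

Lemma has_cderiv_derive1 f z : derivable (f : CC -> CC) z 1 ->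
  has_cderiv f z ((f : CC -> CC)^`()%classic z).
Proof. by move=> df; apply/has_cderivP; rewrite derive1E; apply: derivableP. Qed.

Lemma has_cderiv_derivable f z l : has_cderiv f z l -> derivable (f : CC -> CC) z 1.
Proof. by move=> /has_cderivP[]. Qed.

Definition cdiff f z := exists l, has_cderiv f z l.

Lemma cdiffP f z : cdiff f z <-> derivable (f : CC -> CC) z 1.
Proof.
split=> [[l Hl]|df]; first exact: (has_cderiv_derivable Hl).
by exists ((f : CC -> CC)^`()%classic z); exact: has_cderiv_derive1.
Qed.

Lemma cdiffB f g z : cdiff f z -> cdiff g z -> cdiff (fun w => f w - g w) z.
Proof. by move=> /cdiffP df /cdiffP dg; apply/cdiffP; exact: (derivableB df dg). Qed.

Lemma cdiffM f g z : cdiff f z -> cdiff g z -> cdiff (fun w => f w * g w) z.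
Proof. by move=> /cdiffP df /cdiffP dg; apply/cdiffP; exact: (derivableM df dg). Qed.

Lemma cdiffV f z : f z != 0 -> cdiff f z -> cdiff (fun w => (f w)^-1) z.
Proof. by move=> f0 /cdiffP df; apply/cdiffP; exact: (derivableV f0 df). Qed.

Lemma cdiff_cst c z : cdiff (fun=> c) z.
Proof. by apply/cdiffP; exact: (derivable_cst (c : CC)). Qed.

Lemma cdiffX n z : cdiff (fun w => w ^+ n) z.
Proof. by apply/cdiffP; exact: (@exprn_derivable CC n z 1). Qed.

Lemma cdiff_comp_shift f a z : cdiff f (a + z) -> cdiff (fun w => f (a + w)) z.
Proof.
by move=> [l Hl]; exists l => e /Hl[d d0 Hd]; exists d => // h /Hd; rewrite addrA.
Qed.

Lemma has_cderiv_comp f g z l m :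
  has_cderiv g z l -> has_cderiv f (g z) m -> has_cderiv (f \o g) z (l * m).
Proof.
move=> Hg Hf e e0.
pose K := N l + 1.
have K0 : 0 < K by rewrite ltr_wpDl ?normc_ge0.
pose M := N m + 1.
have M0 : 0 < M by rewrite ltr_wpDl ?normc_ge0.
have [|df df0 Hdf] := Hf (e / 2 / K); first by rewrite !divr_gt0.
have [|d1 d10 Hd1] := Hg (Num.min 1 (e / 2 / M)).
  by rewrite lt_min ltr01 !divr_gt0.
exists (Num.min d1 (df / K)); first by rewrite lt_min d10 divr_gt0.
move=> h; rewrite lt_min => /andP [h1 h2].
set k := g (z + h) - g z.
have H1 := Hd1 h h1.
have kle : N (k - h * l) <= N h.
  by apply: le_trans H1 _; rewrite ler_piMl ?normc_ge0 // ge_min lexx.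
have kle2 : N (k - h * l) <= e / 2 / M * N h.
  by apply: le_trans H1 _; rewrite ler_wpM2r ?normc_ge0 // ge_min lexx orbT.
have Nk : N k <= K * N h.
  rewrite -[k](subrK (h * l)); apply: le_trans (normcDle _ _) _.
  have -> : K * N h = N h + N h * N l by rewrite /K; ring.
  by rewrite ComplexField.Normc.normcM lerD.
have kd : N k < df.
  by apply: le_lt_trans Nk _; rewrite mulrC -ltr_pdivlMr.
have := Hdf k kd.
rewrite /k [g z + _]addrC subrK -/k => H2.
have -> : (f \o g) (z + h) - (f \o g) z - h * (l * m) =
  (f (g (z + h)) - f (g z) - k * m) + (k - h * l) * m by rewrite /=; ring.
apply: le_trans (normcDle _ _) _.
apply: le_trans (lerD H2 (lexx _)) _; rewrite ComplexField.Normc.normcM.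
have -> : e * N h = e / 2 / K * (K * N h) + e / 2 / M * N h * M.
  by field; rewrite !gt_eqF.
apply: lerD; first by rewrite ler_wpM2l // !divr_ge0 // ltW.
by apply: ler_pM => //; rewrite ?normc_ge0 // lerDl.
Qed.

(** * The complex exponential and averages over circles *)

Definition cexp z : C := (expR (complex.Re z) * cos (complex.Im z)) +i*
                         (expR (complex.Re z) * sin (complex.Im z)).

Lemma cexpD z w : cexp (z + w) = cexp z * cexp w.
Proof.
case: z w => [x y] [x' y']; rewrite /cexp /= expRD cosD sinD.
by simpc; congr (_ +i* _); ring.
Qed.

Lemma normc_cexp z : N (cexp z) = expR (complex.Re z).
Proof.
case: z => x y; rewrite /cexp /= !exprMn -mulrDr cos2Dsin2 mulr1 sqrtr_sqr.
by rewrite ger0_norm // expR_ge0.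
Qed.

Lemma is_derive1_near (f : R -> R) (l e : R) : is_derive (0 : R) (1 : R) f l -> 0 < e ->
  exists2 d : R, 0 < d & forall x, `|x| < d -> `|f x - f 0 - x * l| <= e * `|x|.
Proof.
move=> [df <-] e0.
have /cvgrPdist_le /(_ e e0) := df.
move=> /nbhs_ballP [d /= d0 Hd]; exists d => // x xd.
have [->|x0] := eqVneq x 0.
  by rewrite subrr mul0r subr0 normr0 mulr0.
have := Hd x; rewrite /ball /= sub0r normrN => /(_ xd x0).
rewrite addr0 -(@ler_pM2r _ `|x|) ?normr_gt0 // -normrM => H.
apply: le_trans H; rewrite le_eqVlt; apply/orP; left; apply/eqP.
by rewrite -[LHS]normrN; congr (`|_|); rewrite /GRing.scale /= mulr1 /derive; field.
Qed.

Lemma has_cderiv_cexp z : has_cderiv cexp z (cexp z).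
Proof.
have cexp0 : cexp 0 = 1 by rewrite /cexp /= expR0 cos0 sin0 mulr0 mulr1.
suff H0 : has_cderiv cexp 0 1.
  move=> e e0; pose K := N (cexp z).
  have K0 : 0 < K by rewrite /K normc_cexp expR_gt0.
  have [|d d0 Hd] := H0 (e / K); first by rewrite divr_gt0.
  exists d => // h hd; have := Hd h hd; rewrite add0r cexp0 mulr1 => H.
  have -> : cexp (z + h) - cexp z - h * cexp z = cexp z * (cexp h - 1 - h).
    by rewrite cexpD; ring.
  rewrite ComplexField.Normc.normcM -/K.
  have -> : e * N h = K * (e / K * N h) by field; rewrite gt_eqF.
  by rewrite ler_wpM2l // ltW.
move=> e e0.
(* For r = |h| below 1 and e / 8 one gets |exp x - 1| <= 2 r and |exp x| <= 3, so the four error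
   terms add up to at most (1 + 3 + 3 + 4) e r / 16. *)
have e80 : 0 < Num.min 1 (e / 16) by rewrite lt_min ltr01 divr_gt0.
have [d1 d10 H1] := is_derive1_near (is_derive_expR 0) e80.
have [d2 d20 H2] := is_derive1_near (is_derive_cos 0) e80.
have [d3 d30 H3] := is_derive1_near (is_derive_sin 0) e80.
exists (Num.min (Num.min d1 (e / 8)) (Num.min 1 (Num.min d2 d3))) => [|[x y] hd].
  by rewrite !lt_min d10 d20 d30 ltr01 divr_gt0.
rewrite add0r cexp0 mulr1.
have := hd; rewrite !lt_min => /andP[/andP[hd1 hde] /andP[hd01 /andP[hd2 hd3]]].
have Nx := normc_Re (x +i* y); have Ny := normc_Im (x +i* y).
rewrite /= -/(N (x +i* y)) in Nx Ny.
set r := N (x +i* y) in hd1 hd2 hd3 hd01 hde Nx Ny *.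
have {}H1 := H1 x (le_lt_trans Nx hd1).
have {}H2 := H2 y (le_lt_trans Ny hd2).
have {}H3 := H3 y (le_lt_trans Ny hd3).
rewrite expR0 mulr1 in H1; rewrite cos0 sin0 oppr0 mulr0 subr0 in H2.
rewrite sin0 cos0 subr0 mulr1 in H3.
have m1 : Num.min 1 (e / 16) <= 1 by rewrite ge_min lexx.
have m2 : Num.min 1 (e / 16) <= e / 16 by rewrite ge_min lexx orbT.
set m := Num.min _ _ in e80 m1 m2 H1 H2 H3.
have r0 : 0 <= r := normc_ge0 _.
have absM (a b A B : R) : `|a| <= A -> `|b| <= B -> `|a * b| <= A * B.
  by move=> aA bB; rewrite normrM; apply: ler_pM.
have E1 : `|expR x - 1 - x| <= e / 16 * r.
  by apply: le_trans H1 _; apply: ler_pM => //; exact: ltW.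
have E2 : `|cos y - 1| <= e / 16 * r.
  by apply: le_trans H2 _; apply: ler_pM => //; exact: ltW.
have E3 : `|sin y - y| <= e / 16 * r.
  by apply: le_trans H3 _; apply: ler_pM => //; exact: ltW.
have E1' : `|expR x - 1| <= 2 * r.
  rewrite -[_ - 1](subrK x); apply: le_trans (ler_normD _ _) _.
  have : m * `|x| <= 1 * r by apply: ler_pM => //; exact: ltW.
  lra.
have E1'' : `|expR x| <= 3.
  by rewrite -[expR x](subrK 1); apply: le_trans (ler_normD _ _) _; rewrite normr1; lra.
have -> : cexp (x +i* y) - 1 - (x +i* y) =
    ((expR x - 1 - x) + expR x * (cos y - 1)) +i*
    (expR x * (sin y - y) + (expR x - 1) * y).
  by rewrite -cexp0 /cexp /= expR0 cos0 sin0; simpc; congr (_ +i* _); ring.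
apply: le_trans (normc_le _ _) _.
apply: le_trans (lerD (ler_normD _ _) (ler_normD _ _)) _.
have F1 := absM _ _ _ _ E1'' E2.
have F2 := absM _ _ _ _ E1'' E3.
have F3 := absM _ _ _ _ E1' Ny.
have er : 0 <= e * r by rewrite mulr_ge0 // ltW.
have : 2 * r * r <= e / 4 * r.
  by apply: ler_wpM2r => //; lra.
lra.
Qed.

(** For r > 0 this discretises the integral of g(z) dz / (2 pi i z) over the circle of radius [r]:
    [cexp] maps the nodes of the vertical segment to [2 ^ n] equidistant points of the circle. *)
Definition circle_mean n g (r : R) : C :=
  segment_mean n (g \o cexp) (ln r)%:C (0 +i* (2 * pi)).

Lemma normc_circle_mean n g (r e : R) : 0 < r ->
  (forall z, N z = r -> N (g z) <= e) -> N (circle_mean n g r) <= e.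
Proof.
move=> r0 ge; apply: normc_segment_mean => t _ /=; apply: ge.
by rewrite normc_cexp /=; simpc; rewrite lnK.
Qed.

Lemma circle_meanD n f g (r : R) :
  circle_mean n (f \+ g) r = circle_mean n f r + circle_mean n g r.
Proof. exact: segment_meanD. Qed.

Lemma circle_meanZ n c g (r : R) :
  circle_mean n (fun z => c * g z) r = c * circle_mean n g r.
Proof. exact: segment_meanZ. Qed.

Lemma circle_mean_cst n c (r : R) : circle_mean n (fun=> c) r = c.
Proof. exact: segment_mean_cst. Qed.

Lemma normc_circle_mean_sub n g c (r e : R) : 0 < r ->
  (forall z, N z = r -> N (g z - c) <= e) -> N (circle_mean n g r - c) <= e.
Proof.
move=> r0 ge; rewrite -[X in _ - X](circle_mean_cst n c r) -mulN1r -circle_meanZ.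
by rewrite -circle_meanD; apply: normc_circle_mean => // z /ge; rewrite /= mulN1r.
Qed.

Lemma cexp_ipi : cexp (0 +i* pi : C) = -1.
Proof. by rewrite /cexp /= expR0 cospi sinpi mulr0 mul1r; simpc. Qed.

(** Antipodal points cancel; the order [n.+1] makes the number of nodes even. *)
Lemma circle_mean_inv n (r : R) : circle_mean n.+1 (fun z => z^-1) r = 0.
Proof.
rewrite /circle_mean segment_meanS.
have -> : (0 +i* (2 * pi)) / 2 = 0 +i* pi :> C.
  have -> : 0 +i* (2 * pi) = 2 * (0 +i* pi) :> C.
    have -> : (2 : C) = (2 : R)%:C by rewrite rmorph_nat.
    by simpc.
  by rewrite mulrAC divff ?mul1r // pnatr_eq0.
rewrite [X in _ + X]segment_mean_shift.
have -> : (fun w => ((fun z => z^-1) \o cexp) (w + 0 +i* pi)) =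
    (fun w => (-1) * ((fun z => z^-1) \o cexp) w) :> (C -> C).
  by apply/funext => w /=; rewrite cexpD cexp_ipi mulrN1 invrN mulN1r.
by rewrite segment_meanZ mulN1r subrr mul0r.
Qed.

Lemma parallelogram_sum_periodic n F a p q : (forall w, F (w + q) = F w) ->
  parallelogram_sum n F a p q =
  q * (segment_mean n F (a + p) q - segment_mean n F a q).
Proof.
move=> Fq; rewrite /parallelogram_sum (segment_mean_shift n F a q).
by rewrite (_ : (fun w => F (w + q)) = F) ?subrr ?mulr0 ?add0r //; apply/funext.
Qed.

(* Goursat for g \o cexp on a rectangle of height 2 pi, whose horizontal sides cancel. *)
Lemma circle_mean_annulus g (r1 r2 e : R) : 0 < r1 -> r1 <= r2 -> 0 < e ->
  (forall z, r1 <= N z <= r2 -> cdiff g z) ->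
  exists n0, forall n, (n0 <= n)%N ->
    N (circle_mean n g r2 - circle_mean n g r1) <= e.
Proof.
move=> r10 r12 e0 dg.
have r20 : 0 < r2 by apply: lt_le_trans r12.
have p0 : 0 <= ln r2 - ln r1 by rewrite subr_ge0 ler_ln.
have pi2 : 0 < 2 * pi :> R by rewrite mulr_gt0 // pi_gt0.
have [|u v /andP[u1 u2] _|n0 Hn] :=
    @goursat (g \o cexp) (ln r1) 0 (ln r2 - ln r1) (2 * pi) (2 * pi * e) p0 (ltW pi2).
- by rewrite mulr_gt0.
- have [|l Hl] := dg (cexp (u +i* v)).
    rewrite normc_cexp /= -{1}(lnK r10) -(lnK r20) !ler_expR u1.
    by move: u2; rewrite addrC subrK.
  by exists (cexp (u +i* v) * l); apply: has_cderiv_comp => //; apply: has_cderiv_cexp.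
exists n0 => n /Hn.
rewrite parallelogram_sum_periodic; last first.
  move=> w /=; have -> : 0 +i* (2 * pi) = 0 +i* pi + 0 +i* pi :> C.
    by simpc; congr (_ +i* _); ring.
  by rewrite !cexpD cexp_ipi; congr g; ring.
have -> : (ln r1 +i* 0) + (ln r2 - ln r1)%:C = (ln r2)%:C :> C.
  by simpc; rewrite addrC subrK.
rewrite -/(circle_mean n g r2) -/(circle_mean n g r1).
by rewrite ComplexField.Normc.normcM normc_imag gtr0_norm // ler_pM2l.
Qed.

(** The mean of (h z - h 0) / z^k is close to [c] on small circles, changes little up to radius r,
    and is at most 2 M / r^k there. A radius with r^k >= 1/2 gives 4 M whatever [k] is, which makes
    the bound uniform over all orders of contact. *)
Lemma coef_bound (h : C -> C) (M : R) c k :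
  (forall z, N z < 1 -> cdiff h z) ->
  (forall z, N z < 1 -> N (h z) <= M) ->
  (forall e : R, 0 < e -> exists2 d : R, 0 < d &
     forall z, N z < d -> N (h z - h 0 - c * z ^+ k) <= e * N z ^+ k) ->
  N c <= 4 * M.
Proof.
move=> dh hM hc.
have [r [r0 r1 rk]] : exists r : R, [/\ 0 < r, r < 1 & 1 / 2 <= r ^+ k].
  (* Bernoulli's inequality gives r^k >= 1 - k / (2 (k + 1)) >= 1/2; [k.+1] instead of [k] covers k
     = 0. *)
  exists (1 - 1 / (2 * k.+1%:R)).
  have k0 : 0 < 2 * k.+1%:R :> R by rewrite mulr_gt0.
  have i1 : 1 / (2 * k.+1%:R) <= 1 / 2 :> R.
    by rewrite !mul1r lef_pV2 ?posrE // ler_peMr // ler1n.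
  have i0 : 0 < 1 / (2 * k.+1%:R) :> R by rewrite divr_gt0.
  have ik : k.+1%:R * (1 / (2 * k.+1%:R)) = 1 / 2 :> R.
    have : k.+1%:R != 0 :> R by rewrite pnatr_eq0.
    by move: (k.+1%:R : R) => y y0; field.
  set x := 1 / _ in i1 i0 ik *.
  have x1 : x <= 1 by lra.
  have bern j : 1 - j%:R * x <= (1 - x) ^+ j.
    elim: j => [|j IH]; first by rewrite expr0 mul0r subr0.
    rewrite exprS; have : (1 - x) * (1 - j%:R * x) <= (1 - x) * (1 - x) ^+ j.
      by apply: ler_wpM2l => //; rewrite subr_ge0.
    apply: le_trans; rewrite -natr1.
    have : 0 <= j%:R * x * x by rewrite !mulr_ge0 // ltW.
    lra.
  split; [lra|lra|]; apply: le_trans (bern k).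
  have : k%:R * x <= k.+1%:R * x by apply: ler_wpM2r; [exact: ltW|rewrite ler_nat].
  lra.
apply/ler_addgt0Pr => e e0.
have e2 : 0 < e / 2 by rewrite divr_gt0.
have [d d0 Hd] := hc _ e2.
pose g z := (h z - h 0) / z ^+ k.
pose r' := Num.min r (d / 2).
have r'0 : 0 < r' by rewrite lt_min r0 divr_gt0.
have r'r : r' <= r by rewrite ge_min lexx.
have r'd : r' < d.
  by apply: le_lt_trans (_ : d / 2 < d); [rewrite ge_min lexx orbT|lra].
have [z /andP[z1 z2]|n0 Hn] := @circle_mean_annulus g r' r (e / 2) r'0 r'r e2.
  have z0 : z != 0 by rewrite -normc_gt0 (lt_le_trans r'0).
  apply: cdiffM; first by apply: cdiffB; [apply: dh; apply: le_lt_trans r1|apply: cdiff_cst].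
  by apply: cdiffV; [rewrite expf_neq0|apply: cdiffX].
have M0 : 0 <= M by apply: le_trans (hM 0 _); rewrite ?normc_ge0 // ComplexField.Normc.normc0.
have g1 : N (circle_mean n0 g r' - c) <= e / 2.
  apply: normc_circle_mean_sub => // z zr.
  have z0 : z != 0 by rewrite -normc_gt0 zr.
  have := Hd z; rewrite zr => /(_ r'd) H.
  rewrite -(@ler_pM2r _ (r' ^+ k)) ?exprn_gt0 //; apply: le_trans H.
  rewrite -zr -normcX -ComplexField.Normc.normcM /g mulrBl.
  by rewrite divfK // expf_neq0.
have g2 : N (circle_mean n0 g r) <= 4 * M.
  apply: normc_circle_mean => // z zr.
  rewrite /g ComplexField.Normc.normcM ComplexField.Normc.normcV normcX zr.
  rewrite ler_pdivrMr ?exprn_gt0 //; apply: le_trans (normcBle _ _) _.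
  have h1 : N (h z) <= M by apply: hM; rewrite zr.
  have h2 : N (h 0) <= M by apply: hM; rewrite ComplexField.Normc.normc0.
  have : 4 * M * (1 / 2) <= 4 * M * r ^+ k by apply: ler_wpM2l => //; rewrite mulr_ge0.
  lra.
have g3 := Hn n0 (leqnn _).
have -> : c = circle_mean n0 g r - (circle_mean n0 g r - circle_mean n0 g r')
               - (circle_mean n0 g r' - c) by ring.
apply: le_trans (normcBle _ _) _; apply: le_trans (lerD (normcBle _ _) (lexx _)) _.
lra.
Qed.

(** * Mean value inequality, Cauchy estimates and Taylor expansion *)

Lemma has_cderiv_id z : has_cderiv id z 1.
Proof. by apply/has_cderivP; exact: (@is_derive_id CC CC z 1). Qed.

Lemma has_cderivB f g z l m : has_cderiv f z l -> has_cderiv g z m ->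
  has_cderiv (fun w => f w - g w) z (l - m).
Proof. by move=> /has_cderivP df /has_cderivP dg; apply/has_cderivP; exact: (is_deriveB df dg). Qed.

Lemma has_cderivZ f c z l : has_cderiv f z l -> has_cderiv (fun w => c * f w) z (c * l).
Proof. by move=> /has_cderivP df; apply/has_cderivP; exact: (is_deriveZ (c : CC) df). Qed.

Lemma has_cderiv_exp n z : has_cderiv (fun w => w ^+ n.+1) z (n.+1%:R * z ^+ n).
Proof.
apply/has_cderivP; apply: DeriveDef; first exact: (@exprn_derivable CC n.+1 z 1).
by rewrite (@exp_derive CC n.+1 z 1) /= /GRing.scale /= mulr1.
Qed.

Lemma has_cderiv_shift f a z l : has_cderiv f (z + a) l -> has_cderiv (fun w => f (w + a)) z l.
Proof.
by move=> Hl e /Hl[d d0 Hd]; exists d => // h /Hd; rewrite (addrAC z a h).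
Qed.

(** Bisection replaces integration along the segment: a bound by [L + e] on small pieces adds up
    exactly under halving, and the slack [e] is removed at the end. *)
Lemma normc_mean_value f z h (L : R) :
  (forall t : R, 0 <= t <= 1 ->
     exists2 l, has_cderiv f (z + t%:C * h) l & N l <= L) ->
  N (f (z + h) - f z) <= L * N h.
Proof.
move=> df; have [->|h0] := eqVneq h 0.
  by rewrite addr0 subrr ComplexField.Normc.normc0 mulr0.
have Nh : 0 < N h by rewrite normc_gt0.
apply/ler_addgt0Pr => e' e'0.
pose e := e' / N h; have e0 : 0 < e by rewrite divr_gt0.
have -> : L * N h + e' = (L + e) * N h by rewrite /e; field; rewrite gt_eqF.
(* The second coordinate is a dummy: the rectangle has height 0. *)
pose Q k (x y : R) := N (f (z + (x + 1 / 2 ^+ k)%:C * h) - f (z + x%:C * h)) <=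
  (L + e) * N h * (1 / 2 ^+ k).
suff : Q 0%N 0 0.
  by rewrite /Q expr0 divr1 add0r mulr1 mul1r mul0r addr0.
apply: (@bisection Q 0 0 1 0) => // [k x y p' q' H1 H2 _ _|u v u01 _].
  rewrite /Q; have E : 1 / 2 ^+ k = p' + p' :> R.
    by rewrite /p' exprS; field; rewrite expf_neq0.
  rewrite E mulrDr.
  have -> : f (z + (x + (p' + p'))%:C * h) - f (z + x%:C * h) =
    (f (z + (x + p' + p')%:C * h) - f (z + (x + p')%:C * h)) +
    (f (z + (x + p')%:C * h) - f (z + x%:C * h)) by rewrite addrA; ring.
  by apply: le_trans (normcDle _ _) _; apply: lerD.
rewrite add0r in u01.
have [l Hl Nl] := df u u01.
have [d d0 Hd] := Hl e e0.
have [K HK] := exists_half_pow_lt (N h) d0.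
exists K => k x y Kk /andP[xu ux] _; rewrite /Q.
set p := 1 / 2 ^+ k in ux *.
have p0 : 0 <= p by rewrite divr_ge0 // exprn_ge0.
have pd : p * N h < d by rewrite /p mul1r mulrC HK.
set w := z + u%:C * h in Hl Hd.
have small (s : R) : `|s| <= p -> N (f (w + s%:C * h) - f w - s%:C * h * l) <= e * (`|s| * N h).
  move=> sp; have Ns : N (s%:C * h) = `|s| * N h by rewrite ComplexField.Normc.normcM normc_real.
  rewrite -Ns; apply: Hd; rewrite Ns; apply: le_lt_trans pd.
  by rewrite ler_wpM2r // ltW.
have s1 : `|x + p - u| <= p by rewrite ler_norml; lra.
have s2 : `|x - u| <= p by rewrite ler_norml; lra.
have H1 := small _ s1; have H2 := small _ s2.
have wE (s : R) : w + (s - u)%:C * h = z + s%:C * h.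
  by rewrite /w rmorphB /=; ring.
rewrite !wE in H1 H2.
have -> : f (z + (x + p)%:C * h) - f (z + x%:C * h) =
  (f (z + (x + p)%:C * h) - f w - (x + p - u)%:C * h * l) -
  (f (z + x%:C * h) - f w - (x - u)%:C * h * l) + p%:C * h * l.
  by rewrite !rmorphB !rmorphD /=; ring.
apply: le_trans (normcDle _ _) _; apply: le_trans (lerD (normcBle _ _) (lexx _)) _.
apply: le_trans (lerD (lerD H1 H2) (lexx _)) _.
rewrite !ComplexField.Normc.normcM normc_real (ger0_norm p0).
(* As [u] lies between the end points, its distances to them add up to [p], and no factor 2 is
   lost. *)
have -> : `|x + p - u| = x + p - u by rewrite ger0_norm; lra.
have -> : `|x - u| = u - x by rewrite ler0_norm; lra.
have : p * N h * N l <= p * N h * L by apply: ler_wpM2l => //; rewrite mulr_ge0 // ltW.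
lra.
Qed.

(** On a small circle (f (a + z) - f a) / z is close to [l], while f a / z has mean 0 by
    [circle_mean_inv], hence the order [n0.+1]. The annulus estimate carries this to radius [r]. *)
Lemma circle_mean_deriv f a (r e : R) l : 0 < r ->
  (forall z, N z <= r -> cdiff f (a + z)) -> has_cderiv f a l -> 0 < e ->
  exists n, N (circle_mean n (fun z => f (a + z) / z) r - l) <= e.
Proof.
move=> r0 df dl e0; have e2 : 0 < e / 2 by rewrite divr_gt0.
have [d d0 Hd] := dl _ e2.
pose r1 := Num.min r (d / 2).
have r10 : 0 < r1 by rewrite lt_min r0 divr_gt0.
have r1r : r1 <= r by rewrite ge_min lexx.
have r1d : r1 < d.
  by apply: le_lt_trans (_ : d / 2 < d); [rewrite ge_min lexx orbT|lra].
have [z /andP[z1 z2]|n0 Hn] :=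
    @circle_mean_annulus (fun z => f (a + z) / z) r1 r (e / 2) r10 r1r e2.
  have z0 : z != 0 by rewrite -normc_gt0 (lt_le_trans r10).
  apply: cdiffM; first by apply: cdiff_comp_shift; apply: df.
  by apply: cdiffV => //; exists 1; apply: has_cderiv_id.
exists n0.+1; have := Hn n0.+1 (leqnSn _).
set m := circle_mean _ _ r; set m1 := circle_mean _ _ r1 => H.
have H1 : N (m1 - l) <= e / 2.
  have -> : m1 = circle_mean n0.+1 (fun z => (f (a + z) - f a) / z) r1.
    rewrite /m1; have -> : (fun z => f (a + z) / z) =
        (fun z => (f (a + z) - f a) / z) \+ (fun z => f a * z^-1).
      by apply/funext => z /=; ring.
    by rewrite circle_meanD circle_meanZ circle_mean_inv mulr0 addr0.
  apply: normc_circle_mean_sub => // z zr.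
  have z0 : z != 0 by rewrite -normc_gt0 zr.
  have := Hd z; rewrite zr => /(_ r1d) H2.
  rewrite -(@ler_pM2r _ r1) //; apply: le_trans H2.
  by rewrite -zr -ComplexField.Normc.normcM mulrBl divfK // [l * z]mulrC.
have -> : m - l = (m - m1) + (m1 - l) by ring.
by apply: le_trans (normcDle _ _) _; lra.
Qed.

Lemma deriv_bound f a (r M : R) l : 0 < r ->
  (forall z, N z <= r -> cdiff f (a + z)) ->
  (forall z, N z = r -> N (f (a + z)) <= M) -> has_cderiv f a l -> N l <= M / r.
Proof.
move=> r0 df fM dl; apply/ler_addgt0Pr => e e0.
have [n Hn] := circle_mean_deriv r0 df dl e0.
rewrite -[l]opprK -[- l](addKr (circle_mean n (fun z => f (a + z) / z) r)).
rewrite opprD opprK; apply: le_trans (normcBle _ _) _; apply: lerD => //.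
apply: normc_circle_mean => // z zr.
rewrite ComplexField.Normc.normcM ComplexField.Normc.normcV zr ler_pM2r ?invr_gt0 //.
exact: fM.
Qed.

(** Each [u h + K * N h] bounds every [u h' - K * N h'] from above, so the supremum of the latter is
    the limit, with an explicit rate. *)
Lemma cauchy_limit_real (u : C -> R) (K s : R) : 0 < s ->
  (forall h h', 0 < N h < s -> 0 < N h' < s -> `|u h - u h'| <= K * (N h + N h')) ->
  exists l : R, forall h, 0 < N h < s -> `|u h - l| <= K * N h.
Proof.
move=> s0 H.
pose S := [set u h - K * N h | h in [set h | 0 < N h < s]].
have ub h : 0 < N h < s -> ubound S (u h + K * N h).
  move=> hs _ [h' hs' <-]; have := H _ _ hs hs'; rewrite ler_norml; lra.
have hs2 : 0 < N (s / 2)%:C < s.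
  by rewrite normc_real ger0_norm; lra.
have Ss : has_sup S.
  split; first by exists (u (s / 2)%:C - K * N (s / 2)%:C), (s / 2)%:C.
  by exists (u (s / 2)%:C + K * N (s / 2)%:C); apply: ub.
exists (sup S) => h hs.
have h1 : sup S <= u h + K * N h by apply: ge_sup; [case: Ss|apply: ub].
have h2 : u h - K * N h <= sup S by apply: sup_ubound; [case: Ss|exists h].
by rewrite ler_norml; lra.
Qed.

Lemma cauchy_limit (u : C -> C) (K s : R) : 0 < s ->
  (forall h h', 0 < N h < s -> 0 < N h' < s -> N (u h - u h') <= K * (N h + N h')) ->
  exists l, forall h, 0 < N h < s -> N (u h - l) <= 2 * K * N h.
Proof.
move=> s0 H.
have [h h' hs hs'|x Hx] := @cauchy_limit_real (fun h => complex.Re (u h)) K s s0.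
  by rewrite -raddfB; apply: le_trans (normc_Re _) _; apply: H.
have [h h' hs hs'|y Hy] := @cauchy_limit_real (fun h => complex.Im (u h)) K s s0.
  by rewrite -raddfB; apply: le_trans (normc_Im _) _; apply: H.
exists (x +i* y) => h hs; have := Hx h hs; have := Hy h hs.
case: (u h) => a b /= Hb Ha; apply: le_trans (normc_le _ _) _; lra.
Qed.

Lemma has_cderiv_lipschitz_at f a l : has_cderiv f a l ->
  exists2 d : R, 0 < d & forall h, N h < d -> N (f (a + h) - f a) <= (N l + 1) * N h.
Proof.
move=> /(_ 1 ltr01) [d d0 Hd]; exists d => // h hd.
rewrite -[_ - _](subrK (h * l)); apply: le_trans (normcDle _ _) _.
apply: le_trans (lerD (Hd h hd) (lexx _)) _.
by rewrite ComplexField.Normc.normcM; lra.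
Qed.

(* Cauchy estimates for f, for its translates and for its difference quotients
   show that the difference quotients of df at a form a Cauchy family. *)
Lemma cdiff_deriv f (df : C -> C) a (rho : R) : 0 < rho ->
  (forall z, N z < rho -> has_cderiv f (a + z) (df (a + z))) -> cdiff df a.
Proof.
move=> rho0 Hf.
have [d d0 Hd] : exists2 d : R, 0 < d &
    forall h, N h < d -> N (f (a + h) - f a) <= (N (df a) + 1) * N h.
  by apply: has_cderiv_lipschitz_at; have := Hf 0; rewrite ComplexField.Normc.normc0 addr0; apply.
pose rho1 := Num.min rho d.
have rho10 : 0 < rho1 by rewrite lt_min rho0.
pose M := N (f a) + (N (df a) + 1) * d.
have fM z : N z < rho1 -> N (f (a + z)) <= M.
  rewrite lt_min => /andP [_ zd]; rewrite -[f (a + z)](subrK (f a)).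
  apply: le_trans (normcDle _ _) _; rewrite addrC lerD2l.
  apply: le_trans (Hd z zd) _; rewrite ler_wpM2l ?addr_ge0 ?normc_ge0 //.
  exact: ltW.
have {}Hf z : N z < rho1 -> has_cderiv f (a + z) (df (a + z)).
  by rewrite lt_min => /andP [zr _]; apply: Hf.
have M0 : 0 <= M.
  by rewrite addr_ge0 ?normc_ge0 // mulr_ge0 ?addr_ge0 ?normc_ge0 // ltW.
clearbody M; clear Hd.
(* With a quarter of [rho1], base point, increment and Cauchy circle together stay within 3 s of
   [a], hence in the disc where [f] is controlled. *)
pose s := rho1 / 4; have s0 : 0 < s by rewrite divr_gt0.
have rho1E : rho1 = 4 * s by rewrite /s; field.
pose L := M / s; have L0 : 0 <= L by rewrite divr_ge0 // ltW.
have H1 z : N z <= 2 * s -> N (df (a + z)) <= L.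
  move=> zs; apply: (@deriv_bound f (a + z)) => // [w ws|w ws|].
  - rewrite -addrA; exists (df (a + (z + w))); apply: Hf.
    by have := normcDle z w; lra.
  - by rewrite -addrA; apply: fM; have := normcDle z w; lra.
  - by apply: Hf; lra.
have H2 z h : N z <= s -> N h <= s -> N (f (a + z + h) - f (a + z)) <= L * N h.
  move=> zs hs; apply: normc_mean_value => t /andP[t0 t1].
  have Ns : N (z + t%:C * h) <= 2 * s.
    apply: le_trans (normcDle _ _) _.
    rewrite ComplexField.Normc.normcM normc_real ger0_norm //.
    have : t * N h <= 1 * s by apply: ler_pM => //; exact: normc_ge0.
    lra.
  by exists (df (a + (z + t%:C * h))); [rewrite -addrA; apply: Hf; lra|apply: H1].
have H3 z h : N z <= s / 2 -> N h <= s / 2 ->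
    N (df (a + z + h) - df (a + z)) <= L * N h / (s / 2).
  move=> zs hs.
  apply: (@deriv_bound (fun w => f (w + h) - f w) (a + z)) => [|w ws|w ws|].
  - by rewrite divr_gt0.
  - apply: cdiffB.
      exists (df (a + (z + w + h))).
      apply: (@has_cderiv_shift f h); rewrite -!addrA !(addrA z); apply: Hf.
      by have := normcDle (z + w) h; have := normcDle z w; lra.
    exists (df (a + (z + w))); rewrite -addrA; apply: Hf.
    by have := normcDle z w; lra.
  - rewrite -(addrA a z w).
    by apply: H2; [have := normcDle z w; lra|lra].
  - apply: has_cderivB; last by apply: Hf; lra.
    apply: has_cderiv_shift; rewrite -addrA; apply: Hf.
    by have := normcDle z h; lra.
pose L' := L / (s / 2); have L'0 : 0 <= L' by rewrite divr_ge0 // divr_ge0 // ltW.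
have {}H3 z h : N z <= s / 2 -> N h <= s / 2 ->
    N (df (a + z + h) - df (a + z)) <= L' * N h.
  by move=> zs hs; apply: le_trans (H3 z h zs hs) _; rewrite /L' mulrAC.
have H4 z h : N z <= s / 2 -> N h <= s / 2 ->
    N (f (a + z + h) - f (a + z) - h * df (a + z)) <= L' * N h * N h.
  move=> zs hs.
  have -> : f (a + z + h) - f (a + z) - h * df (a + z) =
      (f (a + z + h) - df (a + z) * (a + z + h)) - (f (a + z) - df (a + z) * (a + z)) by ring.
  apply: (@normc_mean_value (fun w => f w - df (a + z) * w)) => t /andP[t0 t1].
  have Nth : N (t%:C * h) <= N h.
    rewrite ComplexField.Normc.normcM normc_real ger0_norm //.
    by rewrite ler_piMl ?normc_ge0.
  exists (df (a + z + t%:C * h) - df (a + z) * 1).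
    apply: has_cderivB; last by apply: has_cderivZ; apply: has_cderiv_id.
    by rewrite -addrA; apply: Hf; have := normcDle z (t%:C * h); lra.
  rewrite mulr1; apply: le_trans (H3 _ _ zs _) _; first lra.
  by rewrite ler_wpM2l.
pose D h w := h^-1 * (f (w + h) - f w).
have H5 z h : N z <= s / 2 -> 0 < N h <= s / 2 ->
    N (D h (a + z) - df (a + z)) <= L' * N h.
  move=> zs /andP[h0 hs]; have hn0 : h != 0 by rewrite -normc_gt0.
  rewrite -(@ler_pM2r _ (N h)) // -ComplexField.Normc.normcM.
  apply: le_trans (H4 z h zs hs); rewrite le_eqVlt; apply/orP; left; apply/eqP.
  by congr N; rewrite /D; field.
pose q h := h^-1 * (df (a + h) - df a).
(* [q h - q h'] is the derivative at [a] of [D h - D h'], which [H5] bounds on the circle of radius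
   s / 2, so that Cauchy's estimate applies. *)
have H6 h h' : 0 < N h < s / 2 -> 0 < N h' < s / 2 ->
    N (q h - q h') <= L' / (s / 2) * (N h + N h').
  move=> /andP[h0 hs] /andP[h'0 h's].
  have -> : L' / (s / 2) * (N h + N h') = L' * (N h + N h') / (s / 2) by rewrite mulrAC.
  have dD k w : N w <= s / 2 -> N k < s / 2 ->
      has_cderiv (D k) (a + w) (k^-1 * (df (a + w + k) - df (a + w))).
    move=> ws ks; apply: has_cderivZ; apply: has_cderivB.
      apply: has_cderiv_shift; rewrite -addrA; apply: Hf.
      by have := normcDle w k; lra.
    by apply: Hf; lra.
  apply: (@deriv_bound (fun w => D h w - D h' w) a) => [|w ws|w ws|].
  - by rewrite divr_gt0.
  - by apply: cdiffB; eexists; apply: dD => //.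
  - have -> : D h (a + w) - D h' (a + w) =
      (D h (a + w) - df (a + w)) - (D h' (a + w) - df (a + w)) by ring.
    apply: le_trans (normcBle _ _) _; rewrite mulrDr; apply: lerD; apply: H5; rewrite ?ws //.
      by rewrite h0 ltW.
    by rewrite h'0 ltW.
  - have d0' : N 0 <= s / 2 by rewrite ComplexField.Normc.normc0 divr_ge0 // ltW.
    have E1 := dD h 0 d0' hs; have E2 := dD h' 0 d0' h's.
    by rewrite !addr0 in E1 E2; apply: has_cderivB.
have [|l Hl] := cauchy_limit _ H6; first by rewrite divr_gt0.
exists l => e e0.
set K := 2 * _ in Hl.
have K0 : 0 <= K.
  by rewrite /K mulr_ge0 // divr_ge0 // divr_ge0 // ltW.
exists (Num.min (s / 2) (e / (K + 1))).
  by rewrite lt_min !divr_gt0 // ltr_wpDl.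
move=> h; rewrite lt_min => /andP [hs he].
have [->|h0] := eqVneq h 0.
  by rewrite addr0 subrr mul0r subr0 ComplexField.Normc.normc0 mulr0.
have Nh : 0 < N h by rewrite normc_gt0.
have := Hl h; rewrite Nh hs => /(_ isT) H.
have -> : df (a + h) - df a - h * l = (q h - l) * h by rewrite /q; field.
rewrite ComplexField.Normc.normcM ler_pM2r //; apply: le_trans H _.
rewrite ltr_pdivlMr in he; last by rewrite ltr_wpDl.
by have := ltW he; have := ltW Nh; lra.
Qed.

(** [F] lists successive derivatives. The induction hypothesis bounds the remainder of the
    derivative [F 1], and the mean value inequality for [F 0] minus its leading term raises the
    order by one. *)
Lemma taylor (F : nat -> C -> C) m (e : R) :
  (forall k z, N z < 1 -> has_cderiv (F k) z (F k.+1 z)) ->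
  (forall k, (k < m)%N -> F k 0 = 0) -> 0 < e ->
  exists2 d : R, 0 < d &
    forall z, N z < d -> N (F 0%N z - z ^+ m * (F m 0 / m`!%:R)) <= e * N z ^+ m.
Proof.
elim: m F e => [|m IH] F e dF F0 e0.
  have [|d d0 Hd] := @has_cderiv_lipschitz_at (F 0%N) 0 (F 1%N 0).
    by apply: dF; rewrite ComplexField.Normc.normc0.
  have K0 : 0 < N (F 1%N 0) + 1 by rewrite ltr_wpDl ?normc_ge0.
  exists (Num.min d (e / (N (F 1%N 0) + 1))); first by rewrite lt_min d0 divr_gt0.
  move=> z; rewrite lt_min => /andP[zd ze].
  have := Hd z zd; rewrite add0r !expr0 mul1r fact0 divr1 => H.
  apply: le_trans H _; rewrite mulr1 mulrC -ler_pdivlMr //; exact: ltW.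
have [k z zr|k km|d d0 Hd] := IH (fun k => F k.+1) e _ _ e0.
- exact: dF.
- by apply: F0.
exists (Num.min d 1); first by rewrite lt_min d0 ltr01.
move=> z; rewrite lt_min => /andP[zd z1].
pose c := F m.+1 0 / m.+1`!%:R.
have cE : F m.+1 0 / m`!%:R = c * m.+1%:R.
  have m0 : m.+1%:R != 0 :> C by rewrite pnatr_eq0.
  have mf0 : m`!%:R != 0 :> C by rewrite pnatr_eq0 -lt0n fact_gt0.
  rewrite /c factS natrM; move: (m.+1%:R : C) (m`!%:R : C) m0 mf0 => x y x0 y0.
  by field; rewrite y0 x0.
pose g w := F 0%N w - c * w ^+ m.+1.
have g0 : g 0 = 0 by rewrite /g F0 // expr0n mulr0 subr0.
have -> : F 0%N z - z ^+ m.+1 * (F m.+1 0 / m.+1`!%:R) = g (0 + z) - g 0.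
  by rewrite g0 subr0 add0r /g -/c [c * _]mulrC.
rewrite exprSr mulrA; apply: normc_mean_value => t /andP[t0 t1].
rewrite add0r; have Nt : N (t%:C * z) <= N z.
  by rewrite ComplexField.Normc.normcM normc_real ger0_norm // ler_piMl ?normc_ge0.
exists (F 1%N (t%:C * z) - c * (m.+1%:R * (t%:C * z) ^+ m)).
  apply: has_cderivB; first by apply: dF; apply: le_lt_trans z1.
  by apply: has_cderivZ; apply: has_cderiv_exp.
have := Hd _ (le_lt_trans Nt zd); rewrite cE => H.
rewrite mulrA [_ * _ ^+ m]mulrC; apply: le_trans H _.
apply: ler_wpM2l; first exact: ltW.
by apply: lerXn2r => //; rewrite nnegrE normc_ge0.
Qed.

End ComplexAnalysis.

(** * Vanishing of the Kobayashi pseudometric *)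

Section KobayashiLowestForms.
Context {R : realType}.
Local Notation C := R[i].
Local Notation N := (@ComplexField.Normc.normc R).
Local Notation CC := (R[i] : numClosedFieldType).

Lemma spectral_ball_eigenvalue n (X : 'M[C]_n) : spectral_ball X ->
  forall a, eigenvalue X a -> `|a| < 1.
Proof.
move=> Xb a aX; suff : N a <= spectral_radius X.
  by move=> /le_lt_trans /(_ Xb); rewrite -ltcR.
have [rs E] := closed_field_poly_normal (char_poly X).
rewrite (monicP (char_poly_monic X)) scale1r in E.
apply: sup_ubound; last by exists a.
(* [sup] needs some upper bound: the sum of the moduli of all roots. *)
exists (\sum_(b <- rs) N b) => _ [b bX <-].
have brs : b \in rs by rewrite -root_prod_XsubC -E -eigenvalue_root_char.
by rewrite (big_rem b) //= lerDl sumr_ge0 // => c _; exact: normc_ge0.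
Qed.

Lemma unit_discE (z : C) : unit_disc (z : CC) <-> N z < 1.
Proof. by rewrite /unit_disc /= -ltcR. Qed.

Lemma derive1_subC n (phi : CC -> 'M[CC]_n) (A : 'M[CC]_n) :
  (fun z => phi z - A)^`()%classic = phi^`()%classic.
Proof.
apply/funext => z; rewrite /derive1.
suff -> : (fun h : CC => h^-1 *: (phi (h + z) - A - (phi z - A))) =
  (fun h => h^-1 *: (phi (h + z) - phi z)) by [].
by apply/funext => h; rewrite opprB addrA subrK.
Qed.

(** Each further derivative is differentiable entry by entry, by [cdiff_deriv] on the disc of radius
    1 - |z| about [z]. This gives sense to vanishing orders, as [holomorphic_on] provides one
    derivative only. *)
Lemma holomorphic_derive1n n (phi : CC -> 'M[CC]_n) k :
  holomorphic_on (@unit_disc CC) phi -> holomorphic_on (@unit_disc CC) (derive1n k phi).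
Proof.
move=> dphi; elim: k => [|k IH]; first by rewrite derive1n0.
move=> z /unit_discE z1.
apply/derivable1_diffP; apply: differentiable_mx_entries => i j.
apply/derivable1_diffP/cdiffP.
have rho0 : 0 < 1 - N z by rewrite subr_gt0.
apply: (cdiff_deriv (f := fun w => derive1n k phi w i j) rho0) => w w1.
apply/has_cderivP; rewrite derive1nS; apply: is_derive_mx_entry; apply: IH.
by apply/unit_discE; have := normcDle z w; lra.
Qed.

(** Entrywise [taylor] for [phi - A]; as m >= 1, subtracting [A] does not change the m-th
    derivative. *)
Lemma cvg_leading_coef n (phi : CC -> 'M[CC]_n) (A : 'M[CC]_n) m : (1 <= m)%N ->
  holomorphic_on (@unit_disc CC) phi -> vanishes_to_order m (fun z => phi z - A) ->
  (z ^+ m)^-1 *: (phi z - A) @[z --> (0 : CC)^'] --> (m`!%:R)^-1 *: derive1n m phi 0.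
Proof.
move=> m1 dphi van.
pose psi (z : CC) := phi z - A.
have dpsi : holomorphic_on (@unit_disc CC) psi.
  by move=> z z1; apply: derivableB; [exact: dphi|exact: derivable_cst].
have -> : derive1n m phi 0 = derive1n m psi 0.
  case: m m1 {van} => [//|m _]; rewrite (derive1Sn phi) (derive1Sn psi).
  exact: (congr1 (fun f => derive1n m f 0) (esym (derive1_subC phi A))).
apply: cvg_mx_entries => i j; apply/cvgrPdist_le => e e0.
have eE : e = (complex.Re e)%:C by rewrite RRe_real // gtr0_real.
have re0 : 0 < complex.Re e by rewrite -ltcR -eE.
have [k z z1|k km|d d0 Hd] := @taylor R (fun k z => derive1n k psi z i j) m _ _ _ re0.
- apply/has_cderivP; rewrite derive1nS; apply: is_derive_mx_entry.
  by apply: holomorphic_derive1n => //; apply/unit_discE.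
- by rewrite van // mxE.
apply/near0C; exists d => // z zd z0; rewrite eE lecR.
have zm : 0 < N (z ^+ m) by rewrite normc_gt0 expf_neq0.
rewrite -(@ler_pM2r _ (N (z ^+ m))) // -ComplexField.Normc.normcM [leRHS]mulrC -/(N _).
have := Hd z zd; rewrite derive1n0 -normcX mulrC => H; apply: le_trans H.
rewrite -[leLHS]normcN le_eqVlt; apply/orP; left; apply/eqP; congr N.
rewrite !mxE.
have mf0 : m`!%:R != 0 :> C by rewrite pnatr_eq0 -lt0n fact_gt0.
by field; rewrite mf0 expf_neq0.
Qed.

Lemma lowest_form_bound n (A B B0 : 'M[CC]_n) (lam alpha : C) (j : 'I_n) d
    (P : mpoly (n * n) CC) :
  N lam < 1 -> B0 = Phi (lam : CC) A -> (0 < d)%N -> P \is ishomog1 d mdeg ->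
  (fun X => sigma_coord j X - sigma_coord j B0 - mxeval P (X - B0)) =o_B0
    (fun X => `|X - B0| ^+ d) ->
  alpha != 0 -> kobayashi_admissible (@spectral_ball R n) A B (alpha : CC) ->
  N (mxeval P ('d (@Phi CC n lam) A B)) <= 4 * 2 ^+ n * N alpha ^+ d.
Proof.
move=> lam1 B0E d0 Pd Po a0 [m [phi [m1 dphi phiO van phim]]].
have lam1' : `|lam : CC| < 1 by rewrite -ltcR in lam1.
have lamc1 : `|(lam : CC)^*%R| < 1 by rewrite norm_conjC.
have phi0 : phi 0 = A by have /eqP := van 0%N m1; rewrite derive1n0 subr_eq0 => /eqP.
have dPhi z : unit_disc (z : CC) -> differentiable (@Phi CC n lam) (phi z).
  move=> z1; apply: differentiable_Phi; apply: unitmx_sub_scale => //.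
  by apply: spectral_ball_eigenvalue; apply: phiO.
have D0 : unit_disc (0 : CC) by apply/unit_discE; rewrite ComplexField.Normc.normc0.
have dPhiA : differentiable (@Phi CC n lam) A by rewrite -phi0; apply: dPhi.
(* The leading coefficient of [phi - A], by the relation that makes [alpha] admissible. *)
pose V := (alpha : CC)^-1 *: B.
have mf0 : m`!%:R != 0 :> CC by rewrite pnatr_eq0 -lt0n fact_gt0.
have VE : (m`!%:R)^-1 *: derive1n m phi 0 = V.
  have -> : derive1n m phi 0 = (alpha : CC)^-1 *: (m`!%:R *: B).
    by rewrite -phim scalerA mulVf // scale1r.
  by rewrite !scalerA mulrAC mulVf // mul1r.
have zm0 : (z : CC) ^+ m @[z --> (0 : CC)^'] --> (0 : CC).
  have := cvg_comp _ _ cvg_id_dnbhs0 (@cvg_exprn CC m 0).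
  by rewrite expr0n gtn_eqF.
have zmn : \forall z \near (0 : CC)^', z ^+ m != 0.
  by apply: filterS near_dnbhs0_neq0 => z z0; rewrite expf_neq0.
have c1 := cvg_leading_coef m1 dphi van; rewrite VE in c1.
pose u z := (z ^+ m)^-1 *: (phi z - A).
(* For nonzero z, [A + z ^+ m *: u z] is [phi z], so [u2] is the rescaled increment of [Phi] along
   the disc; [cvg_lowest_quotient] turns it into the coefficient of degree m d of sigma_j. *)
pose u2 z := (z ^+ m)^-1 *: (Phi (lam : CC) (A + z ^+ m *: u z) - Phi (lam : CC) A).
have c2 : u2 z @[z --> (0 : CC)^'] --> 'd (@Phi CC n lam) A V.
  exact: (cvg_diff_quotient dPhiA zm0 c1 zmn).
rewrite B0E in Po.
have c3 : ((z ^+ m) ^+ d)^-1 * (sigma_coord j (Phi (lam : CC) A + z ^+ m *: u2 z) -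
    sigma_coord j (Phi (lam : CC) A)) @[z --> (0 : CC)^'] -->
    mxeval P ('d (@Phi CC n lam) A V).
  exact: (cvg_lowest_quotient Pd Po zm0 c2 zmn).
pose h (z : C) : C := sigma_coord j (Phi (lam : CC) (phi z)).
pose c : C := mxeval P ('d (@Phi CC n lam) A V).
suff cle : N c <= 4 * 2 ^+ n.
  have -> : mxeval P ('d (@Phi CC n lam) A B) = alpha ^+ d * c.
    rewrite /c /V linearZ /= (mxeval_homog _ _ Pd) exprVn mulVKf //.
    by rewrite expf_neq0.
  by rewrite ComplexField.Normc.normcM normcX mulrC ler_wpM2r // exprn_ge0 // normc_ge0.
apply: (@coef_bound R h (2 ^+ n) c (m * d)).
- move=> z /unit_discE z1; apply/cdiffP/derivable1_diffP.
  have /derivable1_diffP d1 : derivable phi z 1 by apply: dphi.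
  have d2 := differentiable_comp d1 (dPhi z z1).
  exact: (differentiable_comp d2 (differentiable_sigma_coord j _)).
- move=> z /unit_discE z1; rewrite -lecR.
  have := @norm_sigma_coord_le CC n j (Phi (lam : CC) (phi z)).
  rewrite rmorphXn rmorph_nat; apply => b /eigenvalue_Phi H; apply: ltW; apply: H => //.
  by apply: spectral_ball_eigenvalue; apply: phiO.
move=> e e0.
have /cvgrPdist_le /(_ e%:C) := c3; rewrite ltcR => /(_ e0) /near0C [r r0 Hr].
exists r => // z zr; have [->|z0] := eqVneq z 0.
  rewrite subrr sub0r normcN !expr0n muln_eq0 !gtn_eqF // mulr0.
  by rewrite ComplexField.Normc.normc0 expr0n muln_eq0 !gtn_eqF // mulr0.
have := Hr z zr z0.
have zm : z ^+ m != 0 by rewrite expf_neq0.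
have quot (x y a w : C) : w != 0 -> - (x - y - a * w) = (a - w^-1 * (x - y)) * w.
  by move=> w0; field.
have addBK (X Y : 'M[CC]_n) : X + z ^+ m *: ((z ^+ m)^-1 *: (Y - X)) = Y.
  by rewrite scalerA mulfV // scale1r addrC subrK.
have E1 : A + z ^+ m *: u z = phi z by exact: addBK.
have E2 : Phi (lam : CC) A + z ^+ m *: u2 z = Phi (lam : CC) (phi z).
  by rewrite -E1; exact: addBK.
rewrite E2 lecR -/c => H.
have zmd : 0 < N (z ^+ (m * d)) by rewrite normc_gt0 expf_neq0.
move: H; rewrite -exprM -(@ler_pM2r _ (N (z ^+ (m * d)))) // -ComplexField.Normc.normcM => H.
rewrite -normcX; apply: le_trans H.
rewrite -[leLHS]normcN le_eqVlt; apply/orP; left; apply/eqP; congr N.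
rewrite /h phi0; apply: quot; rewrite expf_neq0 //.
Qed.

Lemma kobayashi_eq0_Cprime n (A B : 'M[C]_n) : spectral_ball A ->
  kobayashi (@spectral_ball R n) A B = 0%E -> Cprime A B.
Proof.
move=> Ab k0 lam /= lamA j.
have lam1 : N lam < 1 by rewrite -ltcR; exact: (spectral_ball_eigenvalue Ab).
rewrite /lowest_form; set S := [set P | _].
(* Without a lowest form, [lowest_form] is its default 0, which vanishes everywhere. *)
have [[P0 P0S]|nS] := pselect (exists P, S P); last first.
  by rewrite (@xgetPN _ 0 S) => [|P SP]; [exact: meval0|apply: nS; exists P].
have := @xgetPex _ 0 S (ex_intro _ P0 P0S).
set P := xget 0 S => -[d [d0 Pd _ Po]].
apply: contrapT => /eqP v0.
set v := mxeval P _ in v0.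
have Nv : 0 < N v by rewrite normc_gt0.
pose K : R := 4 * 2 ^+ n.
have K0 : 0 < K by rewrite mulr_gt0 // exprn_gt0.
(* If 0 < |alpha| < e, then K |alpha|^d <= K |alpha| < |v|, against [lowest_form_bound]; the first
   inequality is where e <= 1 serves. *)
pose e := Num.min 1 (N v / (2 * K)).
have e0 : 0 < e by rewrite lt_min ltr01 divr_gt0 // mulr_gt0.
have : (e%:E <= kobayashi (@spectral_ball R n) A B)%E.
  apply: le_ereal_inf_tmp => _ [alpha adm <-]; rewrite lee_fin leNgt; apply/negP => ae.
  (* [alpha = 0] is admissible only for [B = 0], where a form of positive degree vanishes. *)
  have [a0|a0] := eqVneq alpha 0.
    case: adm => m [phi [m1 _ _ _]]; rewrite a0 scale0r => /esym/eqP.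
    rewrite scaler_eq0 pnatr_eq0 gtn_eqF ?fact_gt0 //= => /eqP B0.
    move/eqP: v0; apply; rewrite /v B0 linear0 -(scale0r (0 : 'M[CC]_n)).
    by rewrite (mxeval_homog _ _ Pd) expr0n gtn_eqF // mul0r.
  have := lowest_form_bound lam1 erefl d0 Pd Po a0 adm.
  rewrite -/v -/K leNgt => /negP; apply.
  move: ae; rewrite /e lt_min => /andP[a1 a2].
  have : N alpha ^+ d <= N alpha.
    by rewrite -[leRHS]expr1; apply: ler_wiXn2l; rewrite ?normc_ge0 // ltW.
  rewrite -(ler_pM2l K0) => /le_lt_trans; apply.
  move: a2; rewrite ltr_pdivlMr ?mulr_gt0 // => a2.
  have := normc_ge0 alpha => a3.
  have : 0 <= K * N alpha by rewrite mulr_ge0 // ltW.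
  lra.
by rewrite k0 lee_fin leNgt e0.
Qed.

End KobayashiLowestForms.

Theorem proposition3 (R : realType) (n : nat) (A : 'M[R[i]]_n)
    (hA : (@spectral_ball R n `\` @non_derogatory_ball R n) A) :
  (forall B : 'M[R[i]]_n, kobayashi (@spectral_ball R n) A B = 0%E ->
     Cprime A B) /\
  Cprime A <> ker_dsigma A.
Proof.
have [Ab nA] := hA; split; first by move=> B; exact: kobayashi_eq0_Cprime.
have A1 := spectral_ball_eigenvalue Ab.
have [k [p [l [[p0 [P [Pfree Pfull PA]]] linj]]]] : exists k (p : 'I_k -> nat) (l : 'I_k -> R[i]),
    is_jordan_form A p l /\ ~ injective l.
  apply: contrapT => H; apply: nA; split => // k p l Jl.
  by apply: contrapT => linj; apply: H; exists k, p, l.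
have [i0 [j0 [i0j0 lij]]] : exists i j, i != j /\ l i = l j.
  apply: contrapT => H; apply: linj => i j lij.
  by have [//|ij] := eqVneq i j; case: H; exists i, j.
(* Row free and row full together force equal dimensions; the rows of [A] can then be indexed by
   block and position. *)
have nE : (\sum_(i < k) p i)%N = n.
  by rewrite -(eqP Pfree); exact: (eqP Pfull).
subst n.
have PU : P \in unitmx by rewrite -row_free_unit.
pose blk (a : 'I_(\sum_(i < k) p i)) := tagnat.sig1 a.
pose pos (a : 'I_(\sum_(i < k) p i)) : nat := tagnat.sig2 a.
have inj a b : blk a = blk b -> pos a = pos b -> a = b.
  rewrite /blk /pos => E1 E2; rewrite -(tagnat.sig2K a) -(tagnat.sig2K b).
  move: (tagnat.sig1 a) (tagnat.sig1 b) (tagnat.sig2 a) (tagnat.sig2 b) E1 E2 => i j u v ij.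
  by subst j => /ord_inj ->.
have pos_lt a : (pos a < p (blk a))%N by exact: ltn_ord.
have surj i r : (r < p i)%N -> exists a, blk a = i /\ pos a = r.
  move=> ri; exists (tagnat.Rank i (Ordinal ri)); split; first exact: tagnat.Rank1K.
  by rewrite /pos tagnat.Rank2K.
have JE := @jordan_mxdiagE R[i] k p l.
(* Were the two sets equal, the coupling direction would satisfy the condition of C' at the
   eigenvalue [l i0], which [coupling_notin_Cstar] excludes. *)
move=> E; have lA : spectrum A (l i0).
  exact: (eigenvalue_jordan inj pos_lt surj p0 JE (i0 := i0) erefl PU PA).
have := ker_dsigma_coupling p JE (l i0) PU PA.
rewrite -E => /(_ (l i0) lA).
apply: (coupling_notin_Cstar inj pos_lt surj p0 JE i0j0 _ _ PU PA) => //.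
exact: A1.
Qed.
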